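(* Let $D$ be a DAG with essential graph $\mathcal{E}(D)$, and assume that for every chain component $G\in\mathtt{CC}(\mathcal{E}(D))$ the clique graph $\Gamma_G$ is intersection-incomparable. Then the DCT policy (defined in the context), run on input $\mathcal{E}(D)$ with underlying true DAG $D$, uses at most $$\bigl(3\lceil\log_2\mathcal{C}_{\max}\rceil+2\bigr)\,m(D)$$ single-node interventions, where $\mathcal{C}_{\max}=\max_{G\in\mathtt{CC}(\mathcal{E}(D))}|\mathcal{C}(G)|$.
   Context: All graphs are finite. Two DAGs are Markov equivalent if the same positive distributions are Markov to both (equivalently, same skeleton and same v-structures); $[D]$ is the Markov equivalence class. The essential graph $\mathcal{E}(D)$ has the skeleton of $D$, with $i\to j$ if $i\to j$ in every $D'\in[D]$, and undirected edges otherwise. Its chain components $\mathtt{CC}(\mathcal{E}(D))$ are the connected components of the undirected graph obtained by removing directed edges; they are chordal. A moral DAG is a DAG whose essential graph has a single chain component; for a chain component $G$, $D[V(G)]$ is a moral DAG with skeleton $G$. Interventions. For a set $\mathcal{I}\subseteq V(D)$ of single-node interventions, $[D]_{\mathcal I}$ is the set of DAGs in $[D]$ agreeing with $D$ on every edge incident to a node of $\mathcal I$; $\mathcal{E}_{\mathcal I}(D)$ has the skeleton of $D$, with $i\to j$ iff $i\to j$ in all $D'\in[D]_{\mathcal I}$, and undirected edges otherwise. A policy that has performed the interventions $\mathcal I$ knows $\mathcal{E}_{\mathcal I}(D)$ (noiseless interventions) and chooses its next intervention adaptively. A VIS for $D$ is a set $\mathcal I$ with $\mathcal{E}_{\mathcal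 I}(D)=D$; $m(D)$ is the minimum size of a VIS. Clique trees. For a chordal graph $G$, $\mathcal{C}(G)$ is its set of maximal cliques; a clique tree is a tree on $\mathcal{C}(G)$ such that for each $v\in V(G)$ the cliques containing $v$ induce a subtree; the clique graph $\Gamma_G$ is the union of all clique trees of $G$. Two edges $C_1-C_2$, $C_2-C_3$ are intersection comparable if $C_1\cap C_2\subseteq C_2\cap C_3$ or $C_1\cap C_2\supseteq C_2\cap C_3$, and intersection incomparable otherwise; $\Gamma_G$ is intersection-incomparable if every two distinct edges of $\Gamma_G$ sharing an endpoint are intersection incomparable. For a moral DAG $D$ with skeleton $G$, a directed clique tree (DCT) $T_D$ is a clique tree of $G$ with edge marks: for each ordered pair $(C_1,C_2)$ of adjacent cliques, the mark at $C_2$ is an arrowhead if $v_{12}\to_D v_2$ for all $v_{12}\in C_1\cap C_2$, $v_2\in C_2\setminus C_1$, and a tail otherwise. The directed clique graph (DCG) $\Gamma_D$ is $\Gamma_G$ with edge marks given by the same rule. Bidirected components of $T_D$ are its connected components after removing directed edges. The contracted DCT (CDCT) $\tilde T_D$ has the bidirected components as vertices, with $B_1\to B_2$ if $C_1\to_{T_D}C_2$ for some $C_1\in B_1,C_2\in B_2$; it has no arrow-meets if no vertex has two incoming edges (such a CDCT always exists for some $T_D$). The residual of a vertex $B$ with parent $P$ ($P=\emptyset$ if none) is $\mathrm{Res}_{\tilde T_D}(B)=D|_{B\setminus P}$, where $B,P$ are identified with the unions of their cliques. Clique- and edge-interventions. A clique-intervention on $C$ performs single-node interventions on nodes of $C$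 not yet intervened on, one at a time (chosen at random among the non-dominated nodes of $C$ if there are any, otherwise at random in $C$), until the orientations (marks) of all edges of $\Gamma_D$ incident to $C$ are known. (A node is dominated if all its incident edges are directed, or if its only incident undirected edge goes to a neighbor with more than one incident undirected edge.) An edge-intervention on $C_1-C_2$ performs single-node interventions on random nodes of $C_1\cap C_2$ until the orientation of that edge of $\Gamma_D$ is known. DCT policy. For each chain component $G$ of $\mathcal{E}(D)$ (write $D$ for $D[V(G)]$): Phase 1 (FindDCG). Start with all edges of $\Gamma_G$ of unknown orientation. While some orientation is unknown: (i) let $T$ be a maximum-weight spanning tree (edge weight $|C_1\cap C_2|$) of the subgraph formed by the edges of unknown orientation, and let $C$ be a central node of $T$, i.e. one such that each connected component of $T-\{C\}$ has at most $|V(T)|/2$ nodes; (ii) perform a clique-intervention on $C$; (iii) among the parents $P\to_{\Gamma_D}C$ with $|P\cap C|$ minimal, if there are at least two, perform edge-interventions on all pairs of them, and let $P_{\mathrm{up}}(C)$ be the most upstream parent; let $S$ be the vertex set of the component of $T-\{C\}$ containing $P_{\mathrm{up}}(C)$ ($S=\emptyset$ if there is none); (iv) while there are edges of unknown orientation incident to $\mathcal{C}(G)\setminus S$: propagate orientations as long as possible (if $C_1\to C_2$ or $C_1\leftrightarrow C_2$ is known and $C_2-C_4$ is intersection incomparable with it, conclude $C_2\to C_4$), and if such an edge of unknown orientation still remains, perform an edge-intervention on one. Phase 2. From $\Gamma_D$ form a CDCT $\tilde T_D$ with no arrow-meets; for each vertex $B$ of $\tilde T_D$, intervene on not-yet-intervened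 nodes of $R=\mathrm{Res}_{\tilde T_D}(B)$, one at a time, until $R$ is fully oriented. *)

(* Defs.v *)
From mathcomp Require Import all_boot.
From Stdlib Require Import Relations.Relation_Operators.

Set Implicit Arguments.
Unset Strict Implicit.
Unset Printing Implicit Defensive.

(* A directed graph on T is its set of arcs; an undirected graph is a
   symmetric set of arcs. *)
Notation digraph T := {set (T * T)%type}.

Section Graphs.
Variable T : finType.
Implicit Types (E F : digraph T) (W : {set T}).

Definition arc E : rel T := [rel x y | (x, y) \in E].

Definition induced (A : {set T}) E : digraph {x : T | x \in A} :=
  [set a | (val a.1, val a.2) \in E].

Definition restrict W E : digraph T := E :&: setX W W.

Definition endpoints E : {set T} :=
  [set x | [exists y, ((x, y) \in E) || ((y, x) \in E)]].

(* Tuples longer than #|T| cannot be duplicate-free.  In a symmetric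
   irreflexive graph the cyclic sequences of size 2 are the edges. *)
Definition acyclic_undirected F : bool :=
  [forall n : 'I_#|T|.+1, forall c : n.-tuple T,
     ucycleb (arc F) c ==> (n <= 2)].

Definition is_tree W F : bool :=
  [&& F \subset setX W W,
      [forall x, (x, x) \notin F],
      [forall x, forall y, ((x, y) \in F) == ((y, x) \in F)],
      [forall x in W, forall y in W, connect (arc F) x y]
    & acyclic_undirected F].

(* Node set of the connected component of F - {c} containing x, where F is a
   graph on W; it is empty when x is not in W or x = c. *)
Definition branch W F (c x : T) : {set T} :=
  [set y in W :\ c | connect (arc (restrict (W :\ c) F)) x y].

Definition central W F (c : T) : bool :=
  (c \in W) && [forall x in W :\ c, 2 * #|branch W F c x| <= #|W|].

End Graphs.

Section MarkovEquivalence.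
Variable T : finType.
Implicit Types (D : digraph T) (I : {set T}).

Definition is_dag D : bool :=
  [forall x, forall y, ((x, y) \in D) ==> ~~ connect (arc D) y x].

Definition adjacent D (x y : T) : bool := ((x, y) \in D) || ((y, x) \in D).

Definition v_structure D (x z y : T) : bool :=
  [&& (x, z) \in D, (y, z) \in D, x != y & ~~ adjacent D x y].

(* The graphical form of Markov equivalence (Verma and Pearl): D and D' have the
   same skeleton and the same v-structures. *)
Definition markov_equivalent D D' : bool :=
  [forall x, forall y, adjacent D x y == adjacent D' x y] &&
  [forall x, forall z, forall y, v_structure D x z y == v_structure D' x z y].

Definition MEC D : {set digraph T} :=
  [set D' | is_dag D' & markov_equivalent D D'].

Definition interventional_MEC D I : {set digraph T} :=
  [set D' in MEC D | [forall x, forall y,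
     ((x \in I) || (y \in I)) ==> (((x, y) \in D') == ((x, y) \in D))]].

Definition common_arcs D I : digraph T :=
  [set a | [forall D' in interventional_MEC D I, a \in D']].

(* A mixed graph is the pair of its directed edges and of its undirected edges
   (the latter a symmetric set). *)
Definition interventional_essential D I : digraph T * digraph T :=
  (common_arcs D I,
   [set a | [&& adjacent D a.1 a.2, a \notin common_arcs D I
              & (a.2, a.1) \notin common_arcs D I]]).

Definition undirected_part (M : digraph T * digraph T) : digraph T := M.2.

Definition essential D := interventional_essential D set0.

Definition chain_components D : {set {set T}} :=
  [set [set y | connect (arc (undirected_part (essential D))) x y] | x : T].

Definition chain_graph D (A : {set T}) : digraph {x : T | x \in A} :=
  induced A (undirected_part (essential D)).

Definition is_VIS D I : bool := interventional_essential D I == (D, set0).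

Definition min_VIS D : nat :=
  #|[arg min_(I < [set: T] | is_VIS D I) #|I|]|.

Definition undirected_neighbours D I (x : T) : {set T} :=
  [set y | (x, y) \in undirected_part (interventional_essential D I)].

Definition dominated D I (x : T) : bool :=
  (undirected_neighbours D I x == set0) ||
  [exists y, (undirected_neighbours D I x == [set y]) &&
             (1 < #|undirected_neighbours D I y|)].

Definition fully_oriented D I (R : {set T}) : bool :=
  [forall x in R, forall y in R,
     (x, y) \notin undirected_part (interventional_essential D I)].

End MarkovEquivalence.

Section CliqueGraphs.
Variable T : finType.
Implicit Types (G D : digraph T) (C P : {set T}).

Definition is_clique G C : bool :=
  [forall x in C, forall y in C, (x != y) ==> ((x, y) \in G)].

Definition max_cliques G : {set {set T}} := [set C | maxset (is_clique G) C].

Definition is_clique_tree G (F : digraph {set T}) : bool :=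
  is_tree (max_cliques G) F &&
  [forall v, let Cv := [set C in max_cliques G | v \in C] in
             is_tree Cv (restrict Cv F)].

Definition clique_graph G : digraph {set T} :=
  \bigcup_(F : digraph {set T} | is_clique_tree G F) F.

Definition incomparable C1 C2 C3 : bool :=
  ~~ (C1 :&: C2 \subset C2 :&: C3) && ~~ (C2 :&: C3 \subset C1 :&: C2).

Definition intersection_incomparable G : Prop :=
  forall C1 C2 C3, (C1, C2) \in clique_graph G -> (C2, C3) \in clique_graph G ->
    C1 != C3 -> incomparable C1 C2 C3.

(* The mark at C2 of the edge C1 - C2; a tail is the absence of arrowhead. *)
Definition arrowhead D C1 C2 : bool :=
  [forall v12 in C1 :&: C2, forall v2 in C2 :\: C1, (v12, v2) \in D].

Definition points_to D C1 C2 : bool :=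
  arrowhead D C1 C2 && ~~ arrowhead D C2 C1.

Definition weight (F : digraph {set T}) : nat := \sum_(e in F) #|e.1 :&: e.2|.

(* Every edge is counted in both directions by weight, which does not affect
   maximality. *)
Definition max_spanning_tree (U F : digraph {set T}) : bool :=
  let spanning F' := is_tree (endpoints U) F' && (F' \subset U) in
  spanning F && [forall F' : digraph {set T}, spanning F' ==> (weight F' <= weight F)].

(* In the next four definitions F is a clique tree, marked according to D. *)
Definition bidirected_components G D (F : digraph {set T}) :
    {set {set {set T}}} :=
  let F' := [set e in F | ~~ points_to D e.1 e.2 & ~~ points_to D e.2 e.1] in
  [set [set C' | connect (arc F') C C'] | C in max_cliques G].

Definition cdct_parents G D F (B : {set {set T}}) : {set {set {set T}}} :=
  [set B' in bidirected_components G D F |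
     [exists C1 in B', exists C2 in B,
        ((C1, C2) \in F) && points_to D C1 C2]].

Definition no_arrow_meets G D F : bool :=
  [forall B in bidirected_components G D F, #|cdct_parents G D F B| <= 1].

Definition residual G D F (B : {set {set T}}) : {set T} :=
  cover B :\: \bigcup_(P in cdct_parents G D F B) cover P.

End CliqueGraphs.

Section Policy.
(* D is a moral DAG and G its skeleton. *)
Variables (T : finType) (G D : digraph T).
Implicit Types (C P : {set T}) (S : {set {set T}}) (e : {set T} * {set T}).
Implicit Types (h : seq T) (K F : digraph {set T}) (v : T).

Local Notation GG := (clique_graph G).

Definition performed h : {set T} := [set x in h].

(* The marks of e are the same in all the DAGs compatible with the essential
   graph known after the interventions h. *)
Definition determined h e : bool :=
  [forall D' in interventional_MEC D (performed h),
     (arrowhead D' e.1 e.2 == arrowhead D e.1 e.2) &&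
     (arrowhead D' e.2 e.1 == arrowhead D e.2 e.1)].

Definition learn h K : digraph {set T} :=
  K :|: [set e in GG | determined h e].

(* C1 -> C2 or C1 <-> C2 is known, and C2 - C4 is incomparable with C1 - C2. *)
Definition propagates K C2 C4 : bool :=
  [exists C1, [&& (C1, C2) \in K, arrowhead D C1 C2 & incomparable C1 C2 C4]].

(* K only records which edges have a known orientation, the orientation itself
   being read off D; this is harmless for the conclusion C2 -> C4, which holds
   in D because D has no v-structure. *)
Definition propagate K : digraph {set T} :=
  fixset (fun K' : digraph {set T} =>
    K :|: [set e in GG | propagates K' e.1 e.2 || propagates K' e.2 e.1]).

Definition incident C e : bool := (e.1 == C) || (e.2 == C).

Definition unknown_at C K : digraph {set T} := [set e in GG :\: K | incident C e].

(* The edges of unknown orientation incident to a clique outside S. *)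
Definition unknown_outside S K : digraph {set T} :=
  [set e in GG :\: K | ~~ ((e.1 \in S) && (e.2 \in S))].

Definition clique_choices h C : {set T} :=
  let fresh := C :\: performed h in
  let good := [set v in fresh | ~~ dominated D (performed h) v] in
  if good == set0 then fresh else good.

Definition closest_parents C : {set {set T}} :=
  let pa := [set P | (P, C) \in GG & points_to D P C] in
  [set P in pa | [forall Q in pa, #|P :&: C| <= #|Q :&: C|]].

Definition parent_pairs C : digraph {set T} :=
  restrict (closest_parents C) GG.

Definition most_upstream C : {set {set T}} :=
  [set P in closest_parents C | [forall Q in closest_parents C,
     ((Q, P) \in GG) ==> ~~ points_to D Q P]].

(* Program points.  The tree F carried along a round has vertex set
   endpoints F, as F has at least one edge.  Phase2 and ResidualIntervention
   carry the clique tree and the vertices of its contraction still to be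
   processed. *)
Inductive control :=
| FindDCG
| CliqueIntervention of digraph {set T} & {set T}
| CompareParents of digraph {set T} & {set T}
| Downstream of {set {set T}}
| EdgeIntervention of {set T} * {set T} & control (* then resume *)
| Phase2 of digraph {set T} & {set {set {set T}}}
| ResidualIntervention of digraph {set T} & {set {set {set T}}} & {set T}.

Record state := State { history : seq T; known : digraph {set T}; point : control }.

Inductive step : state -> state -> Prop :=
| step_select h K F C of
    GG :\: K != set0 & max_spanning_tree (GG :\: K) F &
    central (endpoints F) F C :
    step (State h K FindDCG) (State h K (CliqueIntervention F C))
| step_clique h K F C v of
    unknown_at C K != set0 & v \in clique_choices h C :
    step (State h K (CliqueIntervention F C))
         (State (rcons h v) (learn (rcons h v) K) (CliqueIntervention F C))
| step_clique_end h K F C of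
    unknown_at C K = set0 :
    step (State h K (CliqueIntervention F C)) (State h K (CompareParents F C))
| step_edge h K e k v of
    e \notin K & v \in (e.1 :&: e.2) :\: performed h :
    step (State h K (EdgeIntervention e k))
         (State (rcons h v) (learn (rcons h v) K) (EdgeIntervention e k))
| step_edge_end h K e k of
    e \in K :
    step (State h K (EdgeIntervention e k)) (State h K k)
| step_compare h K F C e of
    e \in parent_pairs C & e \notin K :
    step (State h K (CompareParents F C))
         (State h K (EdgeIntervention e (CompareParents F C)))
| step_upstream h K F C P of
    parent_pairs C \subset K & P \in most_upstream C :
    step (State h K (CompareParents F C))
         (State h K (Downstream (branch (endpoints F) F C P)))
| step_no_upstream h K F C of
    parent_pairs C \subset K & most_upstream C = set0 :
    step (State h K (CompareParents F C)) (State h K (Downstream set0))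
| step_propagate h K S of
    unknown_outside S K != set0 & unknown_outside S (propagate K) = set0 :
    step (State h K (Downstream S)) (State h (propagate K) (Downstream S))
| step_propagate_edge h K S e of
    unknown_outside S K != set0 & e \in unknown_outside S (propagate K) :
    step (State h K (Downstream S))
         (State h (propagate K) (EdgeIntervention e (Downstream S)))
| step_downstream_end h K S of
    unknown_outside S K = set0 :
    step (State h K (Downstream S)) (State h K FindDCG)
| step_phase2 h K F of
    GG \subset K & is_clique_tree G F & no_arrow_meets G D F :
    step (State h K FindDCG) (State h K (Phase2 F (bidirected_components G D F)))
| step_residual_start h K F (Bs : {set {set {set T}}}) B of
    B \in Bs :
    step (State h K (Phase2 F Bs))
         (State h K (ResidualIntervention F (Bs :\ B) (residual G D F B)))
| step_residual h K F Bs (R : {set T}) v of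
    ~~ fully_oriented D (performed h) R & v \in R :\: performed h :
    step (State h K (ResidualIntervention F Bs R))
         (State (rcons h v) (learn (rcons h v) K) (ResidualIntervention F Bs R))
| step_residual_end h K F Bs R of
    fully_oriented D (performed h) R :
    step (State h K (ResidualIntervention F Bs R)) (State h K (Phase2 F Bs)).

(* h lists the interventions of some run on G, possibly an unfinished one. *)
Definition component_run h : Prop :=
  exists K k, clos_refl_trans_1n state step
    (State [::] set0 FindDCG) (State h K k).

End Policy.

(* Some (possibly unfinished) execution on all the chain components performs
   exactly n single-node interventions; the order in which the components are
   processed is irrelevant. *)
Definition dct_policy_uses (V : finType) (D : digraph V) (n : nat) : Prop :=
  exists h : forall A : {set V}, seq {x : V | x \in A},
    (forall A, A \in chain_components D ->
       component_run (chain_graph D A) (induced A D) (h A)) /\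
    n = \sum_(A in chain_components D) size (h A).

Definition max_clique_count (V : finType) (D : digraph V) : nat :=
  \max_(A in chain_components D) #|max_cliques (chain_graph D A)|.

(* Main.v *)
Require Import Defs.
From mathcomp Require Import all_boot zify.
From Stdlib Require Import Relations.Relation_Operators.
(* path.v also defines arc. *)
Import Defs.

(**
An edge u -> v with Pa(v) = Pa(u) + u is covered; reversing it yields a Markov
equivalent DAG, so a VIS meets every covered edge.  Hence a VIS of a moral DAG
contains at least floor(|C|/2) nodes for every clique C, and at least
floor(|R|/2) nodes of every clique R whose nodes have the same parents outside R.

If the clique graph is intersection-incomparable, it is a tree (the only clique
tree).  Since there are no v-structures, each of its edges has an arrowhead at
one end or the other, while incomparability allows at most one arrowhead into
each clique.  So, once the edges at the central clique are known, propagation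
orients everything that is not upstream: no edge-intervention is ever performed.
A round thus costs at most |C| <= 3 floor(|C|/2) interventions (|C| >= 2), and
the number of cliques on edges of unknown orientation is halved by each round.
In phase 2, the residuals are pairwise disjoint.  A residual R = C \ P costs at
most |R| - 1 <= 2 floor(|R|/2); the only residual that is not a clique is the
union of the two cliques of a bidirected edge, and at least one of its nodes has
been intervened on in phase 1, since otherwise a covered edge could be reversed
and the orientation of the bidirected edge would not be known.

The essential graph of D is the closure of the v-structures under Meek's rules:
orientations can be completed with any given node as the source of its chain
component, by a perfect elimination ordering.  It follows that the nodes of a
chain component A have the same parents outside A, so that the edges covered in
D[A] are covered in D and the bounds for the components add up.
*)

Set Implicit Arguments.
Unset Strict Implicit.
Unset Printing Implicit Defensive.

(** * Covered edges and lower bounds *)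

Section Dags.
Variable T : finType.
Implicit Types (D : digraph T) (I X C R : {set T}).

(** The number of ancestors is such a rank. It serves as a topological order throughout. *)
Lemma dag_rank D :
  is_dag D -> exists f : T -> nat, forall x y, (x, y) \in D -> f x < f y.
Proof.
move=> /forallP dagD; exists (fun x => #|[set z | connect (arc D) z x]|) => x y xy.
have /forallP/(_ y)/implyP/(_ xy) nyx := dagD x.
apply/proper_card/properP; split.
  apply/subsetP=> z; rewrite !inE => zx.
  by apply: (connect_trans zx); apply: connect1.
by exists y; rewrite !inE ?connect0.
Qed.

Lemma rank_dag D (f : T -> nat) :
  (forall x y, (x, y) \in D -> f x < f y) -> is_dag D.
Proof.
move=> fD; have le_f x y : connect (arc D) x y -> f x <= f y.
  move=> /connectP[p]; elim: p x => [|z p IHp] x /=; first by move=> _ ->.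
  by move=> /andP[/fD xz /IHp {}IHp] /IHp; apply: leq_trans; apply: ltnW.
apply/forallP=> x; apply/forallP=> y; apply/implyP=> /fD xy.
by apply/negP=> /le_f; rewrite leqNgt xy.
Qed.

Lemma dag_asym D x y : is_dag D -> (x, y) \in D -> (y, x) \notin D.
Proof.
by move=> /dag_rank[f fD] /fD xy; apply/negP=> /fD; rewrite ltnNge ltnW.
Qed.

Lemma dag_irr D x : is_dag D -> (x, x) \notin D.
Proof. by move=> /dag_rank[f fD]; apply/negP=> /fD; rewrite ltnn. Qed.

Lemma adjacentC D x y : adjacent D x y = adjacent D y x.
Proof. exact: orbC. Qed.

Lemma dag_trans D x y z : is_dag D ->
  (x, y) \in D -> (y, z) \in D -> adjacent D x z -> (x, z) \in D.
Proof.
move=> /dag_rank[f fD] /fD xy /fD yz /orP[//|/fD zx].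
by have := ltn_trans (ltn_trans xy yz) zx; rewrite ltnn.
Qed.

(** The absence of v-structures, which is the form in which moral DAGs are used. *)
Definition moral D :=
  forall x y z, (x, z) \in D -> (y, z) \in D -> x != y -> adjacent D x y.

Definition covered D u v :=
  (u, v) \in D /\ forall x, x != u -> ((x, v) \in D) = ((x, u) \in D).

(** The only property of a VIS on which the bounds rely. It is inherited by the DAG induced on a
    chain component. *)
Definition covered_hit D X :=
  forall u v, covered D u v -> (u \in X) || (v \in X).

Definition flip D u v : digraph T := (v, u) |: D :\ (u, v).

Lemma in_flip D u v x y : (x, y) \in flip D u v =
  ((x == v) && (y == u)) || (((x != u) || (y != v)) && ((x, y) \in D)).
Proof. by rewrite !inE !xpair_eqE negb_and. Qed.

Lemma adjacent_flip D u v x y :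
  (u, v) \in D -> adjacent (flip D u v) x y = adjacent D x y.
Proof.
move=> uv; rewrite /adjacent !in_flip.
case: (x =P v) => [?|_]; case: (y =P u) => [?|_];
  case: (x =P u) => [?|_]; case: (y =P v) => [?|_]; subst;
  by rewrite ?uv ?orbT ?andbT.
Qed.

Lemma markov_equivalentP D D' :
  reflect ((forall x y, adjacent D x y = adjacent D' x y) /\
           (forall x z y, v_structure D x z y = v_structure D' x z y))
          (markov_equivalent D D').
Proof.
apply: (iffP andP) => [[/forallP adj /forallP vs]|[adj vs]]; split.
- by move=> x y; have /forallP/(_ y)/eqP := adj x.
- by move=> x z y; have /forallP/(_ z)/forallP/(_ y)/eqP := vs x.
- by apply/forallP=> x; apply/forallP=> y; apply/eqP.
- by apply/forallP=> x; apply/forallP=> z; apply/forallP=> y; apply/eqP.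
Qed.

Lemma MEC_refl D : is_dag D -> D \in MEC D.
Proof. by move=> dagD; rewrite inE dagD; apply/markov_equivalentP. Qed.

(** No v-structure uses the edge between [u] and [v], before or after the flip: its other arc would
    come from a common parent of [u] and [v], adjacent to both. *)
Lemma flip_MEC D u v : is_dag D -> covered D u v -> flip D u v \in MEC D.
Proof.
move=> dagD [uv cov]; have [f fD] := dag_rank dagD.
have nvu := dag_asym dagD uv; have nuv : u != v.
  by apply: contraTneq uv => ->; rewrite (negbTE (dag_irr _ dagD)).
have covT x : (x, u) \in D -> (x, v) \in D.
  move=> xu; rewrite cov //; apply: contraTneq xu => ->.
  by rewrite (negbTE (dag_irr _ dagD)).
rewrite inE; apply/andP; split.
  (* Doubling the ranks leaves room for [v] directly before [u]: the common parents stay below, the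
     children of [v] above. *)
  apply: (@rank_dag _ (fun x => if x == v then 2 * f u else 2 * f x + 1)) => x y.
  rewrite in_flip => /orP[/andP[/eqP-> /eqP->]|/andP[ne xy]].
    by rewrite eqxx (negbTE nuv); lia.
  have := fD _ _ xy; have fuv := fD _ _ uv.
  case: (x =P v) => [xv|nxv]; case: (y =P v) => [yv|nyv] /=; rewrite ?xv ?yv; try lia.
  move: ne xy; rewrite yv eqxx orbF => nxu; rewrite cov // => /fD; lia.
apply/markov_equivalentP; split=> [x y|x z y]; first by rewrite adjacent_flip.
rewrite /v_structure adjacent_flip //; case: (boolP (adjacent D x y)).
  by rewrite !andbF.
move=> nadj; rewrite !andbT !in_flip.
case: (boolP (x == y)) => nxy; rewrite /= ?andbF ?andbT //.
have nvpar w w' : ~~ adjacent D w w' -> w != w' -> (w, u) \in D -> w' == v -> False.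
  move=> nad _ wu /eqP w'v; move: nad; rewrite w'v /adjacent covT //.
have npar w w' : ~~ adjacent D w w' -> w != w' -> (w, v) \in D -> w' == u -> False.
  move=> nad nww' wv /eqP w'u; move: nad nww'; rewrite w'u /adjacent => nad ne.
  by move: nad; rewrite -cov // wv.
have nadj' := nadj; rewrite adjacentC in nadj'; have nyx := nxy; rewrite eq_sym in nyx.
case: (z =P u) => [->|_]; rewrite ?andbT ?andbF /=.
  rewrite (negbTE nuv) !orbT /=; apply/idP/idP.
    by move=> /andP[-> ->]; rewrite !orbT.
  case/andP => /orP[xv|xu] /orP[yv|yu].
  - by rewrite (eqP xv) (eqP yv) eqxx in nxy.
  - by case: (nvpar y x).
  - by case: (nvpar x y).
  - by rewrite xu yu.
case: (z =P v) => [->|_]; rewrite ?orbF ?orbT //=.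
apply/idP/idP => [/andP[xv yv]|/andP[/andP[_ ->] /andP[_ ->]]//].
rewrite xv yv !andbT; apply/andP; split; apply/negP => h.
  by case: (npar y x).
by case: (npar x y).
Qed.

Lemma flip_interventional_MEC D I u v : is_dag D -> covered D u v ->
  u \notin I -> v \notin I -> flip D u v \in interventional_MEC D I.
Proof.
move=> dagD cov nu nv; rewrite inE flip_MEC //=.
apply/forallP=> x; apply/forallP=> y; apply/implyP=> xy; apply/eqP.
rewrite in_flip; have [xv|nxv] /= := eqVneq x v; have [yu|nyu] /= := eqVneq y u.
- by move: xy; rewrite xv yu (negbTE nu) (negbTE nv).
- rewrite xv; have [yv|nyv] := eqVneq y v; last by rewrite orbT.
  by move: xy; rewrite xv yv (negbTE nv).
- have [xu|nxu] //= := eqVneq x u; by move: xy; rewrite xu yu (negbTE nu).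
- have [xu|nxu] //= := eqVneq x u; have [yv|nyv] //= := eqVneq y v.
  by move: xy; rewrite xu yv (negbTE nu) (negbTE nv).
Qed.

Lemma dag_interventional_MEC D I : is_dag D -> D \in interventional_MEC D I.
Proof.
move=> dagD; rewrite inE MEC_refl //=; apply/forallP=> x; apply/forallP=> y.
by rewrite eqxx implybT.
Qed.

Lemma VIS_covered_hit D I : is_dag D -> is_VIS D I -> covered_hit D I.
Proof.
move=> dagD /eqP[carcs _] u v cov; apply: contraT; rewrite negb_or => /andP[nu nv].
have := cov.1; rewrite -{1}carcs inE => /forallP/(_ (flip D u v)).
rewrite flip_interventional_MEC //= in_flip !eqxx /= orbF => /andP[_ /eqP uv].
by have := cov.1; rewrite uv (negbTE (dag_irr _ dagD)).
Qed.

(** The witness that makes the [arg min] in [min_VIS] a true minimum. *)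
Lemma is_VIS_setT D : is_dag D -> is_VIS D [set: T].
Proof.
move=> dagD; have eqMEC D' : D' \in interventional_MEC D [set: T] -> D' = D.
  rewrite inE => /andP[_ /forallP eqD]; apply/setP=> [[x y]].
  by have /forallP/(_ y) := eqD x; rewrite !inE /= => /eqP.
have carcs : common_arcs D [set: T] = D.
  apply/setP=> a; rewrite inE; apply/forallP/idP => [/(_ D)|aD D'].
    by rewrite dag_interventional_MEC.
  by apply/implyP=> /eqMEC->.
rewrite /is_VIS /interventional_essential carcs; apply/eqP; congr pair.
apply/setP=> [[x y]]; rewrite !inE /adjacent /=.
by case: ((x, y) \in D); case: ((y, x) \in D).
Qed.

Lemma max_rank (f : T -> nat) R : R != set0 ->
  exists2 v, v \in R & forall w, w \in R -> f w <= f v.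
Proof.
case/set0Pn => v0 v0R; case: (arg_maxnP f v0R) => v vR max_v.
by exists v => // w wR; apply: max_v.
Qed.

Definition clique_in D C := forall x y, x \in C -> y \in C -> x != y -> adjacent D x y.

Section LowerBounds.
Variables (D : digraph T) (X : {set T}).
Hypotheses (dagD : is_dag D) (hitX : covered_hit D X).

(* The two last nodes of R span a covered edge. *)
Lemma module_half R : clique_in D R ->
  (forall x u v, x \notin R -> u \in R -> v \in R -> (x, u) \in D -> (x, v) \in D) ->
  #|R| <= 2 * #|X :&: R| + 1.
Proof.
have [f fD] := dag_rank dagD.
have [n] := ubnP #|R|; elim: n R => // n IHn R; rewrite ltnS => leR cliR modR.
case: (leqP #|R| 1) => [|R_gt1]; first by lia.
have [|v vR max_v] := @max_rank f R; first by rewrite -card_gt0; lia.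
have [|u] := @max_rank f (R :\ v).
  by rewrite -card_gt0; have := cardsD1 v R; rewrite vR; lia.
rewrite !inE => /andP[nuv uR] max_u.
have below_v x : x \in R -> x != v -> (x, v) \in D.
  move=> xR nxv; have /orP[//|/fD] := cliR _ _ xR vR nxv.
  by rewrite ltnNge max_v.
have below_u x : x \in R -> x != v -> x != u -> (x, u) \in D.
  move=> xR nxv nxu; have /orP[//|/fD] := cliR _ _ xR uR nxu.
  by rewrite ltnNge max_u // !inE nxv.
have cov : covered D u v.
  split; first exact: below_v.
  move=> x nxu; have [->|nxv] := eqVneq x v.
    by rewrite (negbTE (dag_irr _ dagD)) (negbTE (dag_asym dagD (below_v _ uR nuv))).
  have [xR|nxR] := boolP (x \in R); first by rewrite below_v ?below_u.
  by apply/idP/idP; apply: modR.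
have := hitX cov => hit.
have cR := cardsD1 v R; rewrite vR in cR.
have cRv := cardsD1 u (R :\ v); rewrite !inE nuv uR in cRv.
have subR : R :\ v :\ u \subset R by apply/subsetP=> x; rewrite !inE => /and3P[].
have : #|R :\ v :\ u| <= 2 * #|X :&: (R :\ v :\ u)| + 1.
  apply: IHn; first by lia.
    by move=> x y /(subsetP subR) xR /(subsetP subR) yR; apply: cliR.
  (* Without its two last nodes [R] is still a module, since neither of them is a parent of an
     earlier node. *)
  move=> x a b nx aR bR; have [xR|nxR] := boolP (x \in R); last first.
    by apply: modR => //; apply: (subsetP subR).
  move: nx aR bR; rewrite !inE xR andbT negb_and !negbK.
  move=> /orP[/eqP->|/eqP->] /and3P[nau nav aR] _.
    by move=> /fD; rewrite ltnNge max_u // !inE nav.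
  by move=> /fD; rewrite ltnNge max_v.
have ltX : #|X :&: (R :\ v :\ u)| < #|X :&: R|.
  apply/proper_card/properP; split; first by rewrite setIS.
  case/orP: hit => hX; [exists u|exists v] => //; rewrite !inE ?hX ?eqxx //=.
  by rewrite eq_sym nuv.
by lia.
Qed.

(** [module_half] does not apply, as the nodes of [C] may have different parents outside [C].
    Instead [C] is enlarged to its last node together with all parents of that node, and such sets
    are treated by induction along the topological order. *)
Lemma clique_half C : moral D -> clique_in D C -> #|C|./2 <= #|X|.
Proof.
move=> moralD cliC; have [f fD] := dag_rank dagD.
pose pa v := [set x | (x, v) \in D].
have last_parent v : pa v != set0 ->
    exists2 u, u \in pa v & pa v \subset u |: pa u.
  move=> /(max_rank f)[u uv max_u]; exists u => //; apply/subsetP=> y yv.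
  rewrite !inE; have [//|nyu /=] := eqVneq y u; move: uv (yv); rewrite !inE => uv yv'.
  have /orP[//|/fD] := moralD _ _ _ yv' uv nyu.
  by rewrite ltnNge max_u.
have paE v : v \notin pa v by rewrite inE dag_irr.
(* The count is restricted to ranks at most [f v] so that a node of [X] found near [v] is not
   already counted further down. *)
have main v : (#|pa v|.+1)./2 <= #|X :&: [set x | f x <= f v]|.
  have [n] := ubnP (f v); elim: n v => // n IHn v; rewrite ltnS => le_v.
  have [->|/last_parent[u uv sub_u]] := eqVneq (pa v) set0; first by rewrite cards0.
  have lt_uv : f u < f v by apply: fD; rewrite inE in uv.
  have cu := cardsU1 u (pa u); rewrite paE /= in cu.
  have monoX w : f w < f v ->
      #|X :&: [set x | f x <= f w]| <= #|X :&: [set x | f x <= f v]|.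
    move=> lt; apply: subset_leq_card; apply: setIS; apply/subsetP=> x.
    by rewrite !inE => /leq_trans; apply; apply: ltnW.
  (* If the inclusion is strict, [v] has no more parents than [u] and induction at [u] suffices;
     otherwise [u -> v] is covered. *)
  have [eq_pa|ne_pa] := eqVneq (pa v) (u |: pa u); last first.
    have : #|pa v| < #|u |: pa u| by apply: proper_card; rewrite properEneq ne_pa.
    have := IHn u (leq_trans lt_uv le_v); have := monoX u lt_uv; lia.
  have cov : covered D u v.
    split; first by rewrite inE in uv.
    by move=> x nxu; have /setP/(_ x) := eq_pa; rewrite !inE (negbTE nxu).
  have hit : exists w, [/\ w \in X, f w <= f v & f u <= f w].
    by case/orP: (hitX cov) => wX; [exists u | exists v]; split=> //; apply: ltnW.
  case: hit => w [wX wv uw]; rewrite eq_pa cu.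
  have [->|/last_parent[u' u'u sub_u']] := eqVneq (pa u) set0.
    rewrite cards0; apply/card_gt0P; exists w; by rewrite !inE wX.
  have lt_u'u : f u' < f u by apply: fD; rewrite inE in u'u.
  have cu' := cardsU1 u' (pa u'); rewrite paE /= in cu'.
  have := subset_leq_card sub_u'.
  have := IHn u' (leq_trans lt_u'u (ltnW (leq_trans lt_uv le_v))).
  (* Going from [v] to [u'] loses at most two parents, hence one unit of the half, and [w] supplies
     this unit because it lies above [u']. *)
  suff : #|X :&: [set x | f x <= f u']| < #|X :&: [set x | f x <= f v]| by lia.
  apply/proper_card/properP; split.
    apply: setIS; apply/subsetP=> x.
    by rewrite !inE; lia.
  by exists w; rewrite !inE wX //=; lia.
have [->|/(max_rank f)[v vC max_v]] := eqVneq C set0; first by rewrite cards0.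
have sub : C \subset v |: pa v.
  apply/subsetP=> x xC; rewrite !inE; have [//|nxv /=] := eqVneq x v.
  by have /orP[//|/fD] := cliC _ _ xC vC nxv; rewrite ltnNge max_v.
have cv := cardsU1 v (pa v); rewrite paE /= in cv.
have := subset_leq_card sub; have := main v.
have := subset_leq_card (subsetIl X [set x | f x <= f v]); lia.
Qed.

End LowerBounds.
End Dags.

(** * Chordal graphs *)

Section PerfectElimination.
Variables (T : finType) (e : rel T).
Hypothesis e_sym : symmetric e.
Implicit Types W : {set T}.

Definition simplicial W t :=
  forall x y, x \in W -> y \in W -> x != y -> e x t -> e y t -> e x y.

(** Chordality in the form of a simplicial node in every nonempty induced subgraph. In the
    application it is the last node in the topological order. *)
Hypothesis chordal : forall W, W != set0 -> exists2 t, t \in W & simplicial W t.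

Lemma simplicial_extend W t a :
  simplicial (W :\ t) a -> ~~ e a t -> simplicial W a.
Proof.
move=> sim nat x y xW yW nxy xa ya; apply: sim => //; rewrite !inE ?xW ?yW andbT.
  by apply: contraNneq nat => <-; rewrite e_sym.
by apply: contraNneq nat => <-; rewrite e_sym.
Qed.

(* Dirac's theorem on chordal graphs. *)
Lemma two_simplicial W :
  (forall x y, x \in W -> y \in W -> x != y -> e x y) \/
  exists a b, [/\ a \in W, b \in W & a != b] /\ [/\ ~~ e a b, simplicial W a & simplicial W b].
Proof.
have [n] := ubnP #|W|; elim: n W => // n IHn W; rewrite ltnS => leW.
have [->|/chordal[t tW simt]] := eqVneq W set0; first by left=> x y; rewrite inE.
have [|complete|[a [b [[aW bW nab] [neab sima simb]]]]] := IHn (W :\ t).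
- by have := cardsD1 t W; rewrite tW; lia.
- have [/exists_inP[w]|] := boolP [exists w in W :\ t, ~~ e w t].
    rewrite !inE => /andP[nwt wW] newt; right; exists w, t; split=> //; split=> //.
    apply: (@simplicial_extend _ t) => // x y xW yW nxy _ _; exact: complete.
  rewrite negb_exists_in => /forall_inP all_t; left=> x y xW yW nxy.
  have adj_t z : z \in W -> z != t -> e z t.
    by move=> zW nzt; have := all_t z; rewrite !inE nzt zW negbK; apply.
  have [xt|nxt] := eqVneq x t; first by rewrite e_sym xt adj_t // -xt eq_sym.
  have [yt|nyt] := eqVneq y t; first by rewrite yt adj_t // -yt.
  by apply: complete; rewrite // !inE ?nxt ?nyt.
- right; move: aW bW; rewrite !inE => /andP[nta aW] /andP[ntb bW].
  have [eat|neat] := boolP (e a t).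
    have nebt : ~~ e b t by apply: contra neab => ebt; apply: simt.
    by exists b, t; split=> //; split=> //; apply: simplicial_extend nebt.
  by exists a, t; split=> //; split=> //; apply: simplicial_extend neat.
Qed.

(** A perfect elimination ordering read backwards. Of two distinct simplicial nodes one differs from
    [r], so [r] can always be kept to the end of the elimination. *)
Lemma rooted_order W r : r \in W -> exists g : T -> nat,
  [/\ {in W &, injective g}, forall x, x \in W -> g r <= g x &
      forall x y z, x \in W -> y \in W -> z \in W -> g x < g z -> g y < g z ->
        x != y -> e x z -> e y z -> e x y].
Proof.
have [n] := ubnP #|W|; elim: n W => // n IHn W; rewrite ltnS => leW rW.
have [W1|[t0 t0W nt0r]] : W = [set r] \/ exists2 t, t \in W & t != r.
  have [/exists_inP[t]|] := boolP [exists t in W, t != r]; first by right; exists t.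
  rewrite negb_exists_in => /forall_inP allr; left; apply/setP=> x; rewrite inE.
  by apply/idP/eqP => [/allr/negPn/eqP|->].
  by exists (fun=> 0); split=> // x y; rewrite W1 !inE => /eqP-> /eqP->.
have [t [tW ntr simt]] : exists t, [/\ t \in W, t != r & simplicial W t].
  have [complete|[a [b [[aW bW nab] [_ sima simb]]]]] := two_simplicial W.
    by exists t0; split=> // x y xW yW nxy _ _; apply: complete.
  have [ar|nar] := eqVneq a r; last by exists a.
  by exists b; split=> //; rewrite -ar eq_sym.
have [||g [g_inj g_min g_sim]] := IHn (W :\ t).
- by have := cardsD1 t W; rewrite tW; lia.
- by rewrite !inE eq_sym ntr.
pose m := (\max_x g x).+1.
have g_lt x : g x < m by rewrite ltnS leq_bigmax.
exists (fun x => if x == t then m else g x); split.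
- move=> x y xW yW; have [->|nxt] := eqVneq x t; have [->|nyt] := eqVneq y t => //.
  + by move=> E; have := g_lt y; rewrite -E ltnn.
  + by move=> E; have := g_lt x; rewrite E ltnn.
  by apply: g_inj; rewrite !inE ?nxt ?nyt.
- move=> x xW; rewrite eq_sym (negbTE ntr); have [_|nxt] := eqVneq x t.
    exact/ltnW/g_lt.
  by apply: g_min; rewrite !inE nxt.
- move=> x y z xW yW zW; have [->|nzt] := eqVneq z t; first by move=> _ _; apply: simt.
  have [_|nxt] := eqVneq x t; first by move=> /(ltn_trans (g_lt z)); rewrite ltnn.
  have [_|nyt] := eqVneq y t; first by move=> _ /(ltn_trans (g_lt z)); rewrite ltnn.
  by apply: g_sim; rewrite !inE ?nxt ?nyt ?nzt.
Qed.

End PerfectElimination.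

(** * Essential graphs *)

Section EssentialGraphs.
Variables (V : finType) (D : digraph V).
Hypothesis dagD : is_dag D.

Let adj := adjacent D.

(* The third rule is Meek's, with "e - a - f is undirected" weakened to "e, a, f
   is not a v-structure", so that the rules form a monotone operator. *)
Definition meek_step (N : digraph V) : digraph V :=
  [set a | [|| [exists c, v_structure D a.1 a.2 c]
    | adj a.1 a.2 && [|| [exists c, [&& (c, a.1) \in N, c != a.2, ~~ adj c a.2
          & ~~ v_structure D c a.1 a.2]],
        [exists c, ((a.1, c) \in N) && ((c, a.2) \in N)]
      | [exists e, exists f, [&& (e, a.2) \in N, (f, a.2) \in N, e != f,
          ~~ adj e f, adj a.1 e, adj a.1 f & ~~ v_structure D e a.1 f]]]]].

Definition meek : digraph V := fixset meek_step.

Lemma meek_step_mono : {homo meek_step : M N / M \subset N}.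
Proof.
move=> M N /subsetP MN; apply/subsetP=> [[a b]]; rewrite !inE /=.
case/orP=> [->//|/andP[-> /=]] /or3P[/existsP[c /and4P[ca cb ncb nvs]]|
  /existsP[c /andP[ac cb]]|/existsP[e /existsP[f /and5P[eb fb ef nef rest]]]].
- by apply/orP; right; apply/or3P/Or31/existsP; exists c; rewrite MN ?cb ?ncb.
- by apply/orP; right; apply/or3P/Or32/existsP; exists c; rewrite !MN.
- apply/orP; right; apply/or3P/Or33/existsP; exists e; apply/existsP; exists f.
  by rewrite !MN // ef nef.
Qed.

Lemma meekE : meek_step meek = meek.
Proof. exact: fixsetK meek_step_mono. Qed.

Lemma meek_vs a b c : v_structure D a b c -> (a, b) \in meek.
Proof. by move=> vs; rewrite -meekE inE; apply/orP; left; apply/existsP; exists c. Qed.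

Lemma meek1 a b c : (c, a) \in meek -> adj a b -> c != b -> ~~ adj c b ->
  ~~ v_structure D c a b -> (a, b) \in meek.
Proof.
move=> ca ab cb ncb nvs; rewrite -meekE inE ab; apply/orP; right; apply/or3P/Or31.
by apply/existsP; exists c; rewrite ca cb ncb.
Qed.

Lemma meek2 a b c : (a, c) \in meek -> (c, b) \in meek -> adj a b -> (a, b) \in meek.
Proof.
move=> ac cb ab; rewrite -meekE inE ab; apply/orP; right; apply/or3P/Or32.
by apply/existsP; exists c; rewrite ac cb.
Qed.

Lemma meek3 a b e f : (e, b) \in meek -> (f, b) \in meek -> e != f -> ~~ adj e f ->
  adj a e -> adj a f -> ~~ v_structure D e a f -> adj a b -> (a, b) \in meek.
Proof.
move=> eb fb ef nef ae af vs ab; rewrite -meekE inE ab; apply/orP; right.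
apply/or3P/Or33/existsP; exists e; apply/existsP; exists f.
by rewrite eb fb ef nef ae af.
Qed.

Lemma meekP a b : (a, b) \in meek ->
  [\/ exists c, v_structure D a b c,
      adj a b /\ exists c, [/\ (c, a) \in meek, c != b, ~~ adj c b & ~~ v_structure D c a b],
      adj a b /\ exists c, (a, c) \in meek /\ (c, b) \in meek
    | adj a b /\ exists e f, [/\ [/\ (e, b) \in meek, (f, b) \in meek, e != f & ~~ adj e f],
        adj a e, adj a f & ~~ v_structure D e a f]].
Proof.
rewrite -{1}meekE inE /=.
case/orP=> [/existsP[c vs]|/andP[ab]]; first by apply: Or41; exists c.
case/or3P=> [/existsP[c /and4P[ca cb ncb nvs]]|/existsP[c /andP[ac cb]]|
  /existsP[e /existsP[f /and5P[eb fb ef nef /and3P[ae af vs]]]]].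
- by apply: Or42; split=> //; exists c.
- by apply: Or43; split=> //; exists c.
- by apply: Or44; split=> //; exists e, f.
Qed.

Lemma v_structure_sym (E : digraph V) a b c : v_structure E a b c = v_structure E c b a.
Proof.
rewrite /v_structure adjacentC eq_sym.
by case: ((a, b) \in E); case: ((c, b) \in E).
Qed.

Lemma common_arcs_sub I : common_arcs D I \subset D.
Proof.
apply/subsetP=> a; rewrite inE => /forallP/(_ D).
by rewrite dag_interventional_MEC.
Qed.

Lemma interventional_MEC0 : interventional_MEC D set0 = MEC D.
Proof.
apply/setP=> D'; rewrite inE andb_idr // => _.
by apply/forallP=> x; apply/forallP=> y; rewrite !inE.
Qed.

(** Soundness of the rules, by induction on the stages of the fixed point: reversing a conclusion
    would create in [D'] a directed cycle or a v-structure that [D] does not have. *)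
Lemma meek_sub_MEC D' : D' \in MEC D -> meek \subset D'.
Proof.
rewrite inE => /andP[dagD' /markov_equivalentP[eqadj eqvs]].
have vsP x y z : (x, z) \in D' -> (y, z) \in D' -> x != y -> ~~ adj x y ->
    v_structure D x z y.
  by move=> xz yz xy nxy; rewrite eqvs /v_structure xz yz xy -eqadj.
rewrite /meek /fixset; elim: #|_| => [|n IHn]; first by rewrite sub0set.
apply: subset_trans (meek_step_mono IHn) _; apply/subsetP=> [[a b]] {n IHn}.
rewrite inE /= => /orP[/existsP[c]|/andP[ab]].
  by rewrite eqvs => /and4P[].
have /orP[//|ba] : adjacent D' a b by rewrite -eqadj.
case/or3P=> [/existsP[c /and4P[ca cb ncb nvs]]|/existsP[c /andP[ac cb]]|
  /existsP[e /existsP[f /and5P[eb fb ef nef /and3P[ae af]]]]].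
- by case/negP: nvs; apply: vsP.
- by apply: (dag_trans dagD' ac cb); rewrite -eqadj.
- case/negP; apply: vsP => //; apply: (dag_trans dagD' _ ba) => //.
    by rewrite -eqadj adjacentC.
  by rewrite -eqadj adjacentC.
Qed.

Lemma meek_arc a b : (a, b) \in meek -> (a, b) \in D.
Proof. by apply/subsetP/meek_sub_MEC/MEC_refl. Qed.

Definition undirected a b :=
  [&& adj a b, (a, b) \notin meek & (b, a) \notin meek].

Lemma undirectedC a b : undirected a b = undirected b a.
Proof. by rewrite /undirected /adj adjacentC [X in _ && X]andbC. Qed.

Lemma meek_adj a b : (a, b) \in meek -> adj a b.
Proof. by move=> /meek_arc ab; rewrite /adj /adjacent ab. Qed.

(** This is why the nodes of a chain component share their outside parents. Induction on the rank of
    [b], by cases on the rule that produced [(a, b)]: if [(a, c)] were missing, [a - c] would be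
    undirected, and the rules would orient it or [b - c]. *)
Lemma meek_undirected a b c : (a, b) \in meek -> undirected b c -> (a, c) \in meek.
Proof.
have [rk rkD] := dag_rank dagD.
have [n] := ubnP (rk b); elim: n a b c => // n IHn a b c; rewrite ltnS => le_b ab Ubc.
have /and3P[bc nbc ncb] := Ubc.
have cb : adj c b by rewrite /adj adjacentC.
have adjC x y : adj x y = adj y x by rewrite /adj adjacentC.
have Mb x : (x, b) \in meek -> adj x c.
  move=> xb; apply: contraR nbc => nxc; apply: (meek1 xb bc _ nxc).
    by apply: contraNneq ncb => <-.
  by apply: contra ncb; rewrite v_structure_sym; apply: meek_vs.
have ac : adj a c by apply: Mb.
have ca : adj c a by rewrite adjC.
apply: contraT => nac.
have nca : (c, a) \notin meek by apply: contra ncb => /meek2; apply.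
have nMcx x : (x, b) \in meek -> (c, x) \notin meek.
  by move=> xb; apply: contra ncb => /meek2; apply.
have Uac : undirected a c by rewrite /undirected ac nac.
case: (meekP ab) => [[d vs]|[_ [d [da db ndb nvs]]]|[_ [d [ad db]]]|
    [_ [e [f [[eb fb nef naef] ae af nvs]]]]].
- have Mdb : (d, b) \in meek by apply: (@meek_vs _ _ a); rewrite v_structure_sym.
  have /and4P[_ _ nad nadj_ad] := vs.
  have dc := Mb _ Mdb.
  have [Mdc|nMdc] := boolP ((d, c) \in meek).
    case/negP: nca; apply: (meek1 Mdc ca); rewrite 1?eq_sym 1?adjC //.
    by apply: contra nac; rewrite v_structure_sym; apply: meek_vs.
  case/negP: ncb; apply: (meek3 ab Mdb nad nadj_ad) => //; first by rewrite adjC.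
  by apply: contra nac; apply: meek_vs.
- have Mdc : (d, c) \in meek.
    by apply: (IHn d a c) => //; apply: leq_trans le_b; apply: rkD; apply: meek_arc.
  case/negP: ncb; apply: (meek1 Mdc cb db ndb).
  by apply: contra nbc; rewrite v_structure_sym; apply: meek_vs.
- have dc := Mb _ db; have [Mdc|nMdc] := boolP ((d, c) \in meek).
    by case/negP: nac; apply: (meek2 ad Mdc).
  case/negP: nac; apply: (IHn a d c) => //.
    by apply: leq_trans le_b; apply: rkD; apply: meek_arc.
  by rewrite /undirected dc nMdc nMcx.
- have ec := Mb _ eb; have fc := Mb _ fb.
  have both x y : (x, b) \in meek -> (y, b) \in meek -> x != y -> ~~ adj x y ->
      (x, c) \in meek -> (y, c) \in meek.
    move=> xb yb nxy naxy xc; apply: contraR (nMcx _ yb) => nyc.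
    apply: (meek1 xc) => //; first by rewrite adjC Mb.
    by apply: contra nyc; rewrite v_structure_sym; apply: meek_vs.
  suff [ecM fcM] : (e, c) \in meek /\ (f, c) \in meek.
    by case/negP: nac; apply: (meek3 ecM fcM).
  have [ecM|necM] := boolP ((e, c) \in meek); first by rewrite (both e f).
  have [fcM|nfcM] := boolP ((f, c) \in meek).
    by case/negP: necM; apply: (both f e) => //; rewrite 1?eq_sym 1?adjC.
  case/negP: ncb; apply: (meek3 eb fb nef naef) => //; try by rewrite adjC.
  by apply: contra necM; apply: meek_vs.
Qed.

(** It makes the undirected part chordal: the last node of any set is simplicial. *)
Lemma undirected_moral x y t : (x, t) \in D -> (y, t) \in D -> x != y ->
  undirected x t -> undirected y t -> undirected x y.
Proof.
move=> xt yt nxy Uxt Uyt; have /and3P[_ nMxt _] := Uxt; have /and3P[_ nMyt _] := Uyt.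
apply/and3P; split.
- apply: contraR nMxt => naxy; apply: (@meek_vs _ _ y).
  by rewrite /v_structure xt yt nxy.
- by apply: contra nMxt => /meek_undirected; apply.
- by apply: contra nMyt => /meek_undirected; apply.
Qed.

(** The arcs of [meek] are kept, and the undirected edges are oriented along a perfect elimination
    ordering that starts at [b]. *)
Lemma reorient a b : undirected a b -> exists2 D', D' \in MEC D & (b, a) \in D'.
Proof.
move=> Uab; have [rk rkD] := dag_rank dagD.
have chordal W : W != set0 -> exists2 t, t \in W & simplicial undirected W t.
  move=> /(max_rank rk)[t tW max_t]; exists t => // x y xW yW nxy Uxt Uyt.
  have arc_t z : z \in W -> undirected z t -> (z, t) \in D.
    by move=> zW /and3P[/orP[//|/rkD tz] _ _]; move: tz; rewrite ltnNge max_t.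
  by apply: (@undirected_moral x y t) => //; apply: arc_t.
have [g [g_inj g_min g_sim]] :=
  rooted_order undirectedC chordal (in_setT b).
have g_lt x y : undirected x y -> (g x < g y) || (g y < g x).
  move=> /and3P[xy _ _]; rewrite -neq_ltn; apply: contraTneq xy => /g_inj -> //.
  by rewrite /adj /adjacent !(negbTE (dag_irr _ dagD)).
pose D' : digraph V := meek :|: [set u | undirected u.1 u.2 & g u.1 < g u.2].
have D'E x y : ((x, y) \in D') = ((x, y) \in meek) || (undirected x y && (g x < g y)).
  by rewrite !inE.
exists D'; last first.
  rewrite D'E undirectedC Uab; have := g_lt _ _ Uab; rewrite [g a < g b]ltnNge g_min //=.
  by move->; rewrite orbT.
have sub_adj x y : (x, y) \in D' -> adj x y.
  by rewrite D'E => /orP[/meek_adj|/andP[/and3P[]]].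
have eqadj x y : adjacent D x y = adjacent D' x y.
  apply/idP/idP => [xy|]; last first.
    by case/orP=> /sub_adj; rewrite // /adj adjacentC.
  rewrite /adjacent !D'E; case: (boolP (_ \in meek)) => //= nxy.
  case: (boolP ((y, x) \in meek)) => [|nyx]; first by rewrite orbT.
  have Uxy : undirected x y by rewrite /undirected /adj xy nxy.
  by rewrite Uxy undirectedC Uxy g_lt.
rewrite inE; apply/andP; split.
  (* The new graph is ranked lexicographically. The number of proper [meek]-ancestors comes first:
     it grows along [meek] and, by [meek_undirected], is constant along undirected edges, where [g]
     decides. *)
  pose anc x := [set z | [exists p, connect (arc meek) z p && ((p, x) \in meek)]].
  have anc_meek x y : (x, y) \in meek -> #|anc x| < #|anc y|.
    move=> xy; apply/proper_card/properP; split.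
      apply/subsetP=> z; rewrite !inE => /existsP[p /andP[zp px]]; apply/existsP.
      by exists x; rewrite xy andbT (connect_trans zp) ?connect1.
    exists x; rewrite !inE; first by apply/existsP; exists x; rewrite connect0.
    apply/existsP=> [[p /andP[xp px]]].
    have /forallP/(_ p)/forallP/(_ x)/implyP/(_ (meek_arc px))/negP := dagD; apply.
    apply: connect_sub xp => u v uv; apply/connect1/meek_arc/uv.
  have anc_und x y : undirected x y -> #|anc x| = #|anc y|.
    move=> Uxy; congr #|pred_of_set _|; apply/setP=> z; rewrite !inE.
    apply: eq_existsb => p; congr (_ && _).
    by apply/idP/idP => /meek_undirected; apply; rewrite // undirectedC.
  pose m := (\max_x g x).+1.
  apply: (@rank_dag _ _ (fun x => #|anc x| * m + g x)) => x y.
  have gx : g x < m by rewrite ltnS leq_bigmax.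
  rewrite D'E => /orP[/anc_meek xy|/andP[/anc_und -> xy]]; last by rewrite ltn_add2l.
  apply: leq_trans (leq_addr _ _); apply: (@leq_trans (#|anc x|.+1 * m)).
    by rewrite mulSn addnC ltn_add2r.
  by rewrite leq_mul2r xy orbT.
apply/markov_equivalentP; split=> // x z y; apply/idP/idP => vs.
  have /and4P[_ _ nxy naxy] := vs.
  rewrite /v_structure -eqadj nxy naxy !D'E (meek_vs vs).
  by rewrite v_structure_sym in vs; rewrite (meek_vs vs).
have /and4P[xz yz nxy] := vs; rewrite -eqadj => naxy.
(* No v-structure is new: two arcs of [meek] were in [D], a mixed pair has adjacent tails by
   [meek_undirected], and two oriented undirected edges have adjacent tails by the choice of [g]. *)
suff [xzD yzD] : (x, z) \in D /\ (y, z) \in D by rewrite /v_structure xzD yzD nxy.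
have mixed u v : (u, z) \in meek -> undirected v z -> u != v -> adj u v.
  by move=> uz Uvz _; apply: meek_adj; apply: meek_undirected uz _; rewrite undirectedC.
move: xz yz; rewrite !D'E => /orP[xz|/andP[Uxz gxz]] /orP[yz|/andP[Uyz gyz]].
- by rewrite !meek_arc.
- by case/negP: naxy; apply: mixed xz Uyz nxy.
- case/negP: naxy; rewrite adjacentC; apply: mixed yz Uxz _; by rewrite eq_sym.
- by case/negP: naxy; have /and3P[] : undirected x y by apply: (g_sim x y z).
Qed.

Lemma meek_complete : common_arcs D set0 = meek.
Proof.
apply/setP=> [[a b]]; apply/idP/idP => [|ab]; last first.
  rewrite inE interventional_MEC0; apply/forall_inP=> D' /meek_sub_MEC/subsetP; exact.
move=> ab; apply: contraT => nab.
have abD : (a, b) \in D by apply: (subsetP (common_arcs_sub set0)).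
have [ba|nba] := boolP ((b, a) \in meek).
  by have := dag_asym dagD abD; rewrite meek_arc.
have [|D' D'MEC baD'] := @reorient a b; first by rewrite /undirected nab nba /adj /adjacent abD.
move: ab; rewrite inE interventional_MEC0 => /forall_inP/(_ D' D'MEC) abD'.
move: D'MEC; rewrite inE => /andP[dagD' _].
by have := dag_asym dagD' abD'; rewrite baD'.
Qed.

Lemma essentialE x y : ((x, y) \in undirected_part (essential D)) = undirected x y.
Proof. by rewrite inE meek_complete. Qed.

Lemma connect_essential x y :
  connect (arc (undirected_part (essential D))) x y = connect undirected x y.
Proof. by apply: eq_connect => u v; apply: essentialE. Qed.

Lemma undirected_csym : connect_sym undirected.
Proof. exact/sym_connect_sym/undirectedC. Qed.

Lemma chain_componentP A : A \in chain_components D ->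
  exists x, forall y, (y \in A) = connect undirected x y.
Proof. by case/imsetP=> x _ ->; exists x => y; rewrite inE connect_essential. Qed.

Lemma chain_component_connect A x y : A \in chain_components D ->
  x \in A -> (y \in A) = connect undirected x y.
Proof.
move=> /chain_componentP[z inA]; rewrite !inA => zx.
exact: (same_connect undirected_csym zx).
Qed.

Lemma chain_components_disjoint A B x : A \in chain_components D ->
  B \in chain_components D -> x \in A -> x \in B -> A = B.
Proof.
move=> cA cB xA xB; apply/setP=> y.
by rewrite (chain_component_connect y cA xA) (chain_component_connect y cB xB).
Qed.

Lemma meek_connect x u v : (x, u) \in meek -> connect undirected u v -> (x, v) \in meek.
Proof.
move=> xu /connectP[p]; elim: p u xu => [|w p IHp] u xu /=; first by move=> _ ->.
by case/andP=> uw; apply: IHp; apply: meek_undirected xu uw.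
Qed.

(** * The DAG induced on a chain component *)

Section ChainComponent.
Variable A : {set V}.
Hypothesis compA : A \in chain_components D.

Local Notation T := {x : V | x \in A}.
Local Notation DA := (induced A D).

(** A [meek] arc inside [A] would spread along an undirected path back to its own tail and give a
    loop. *)
Lemma adj_undirected x y : x \in A -> y \in A -> adj x y -> undirected x y.
Proof.
have irr z : (z, z) \notin meek by apply: contra (dag_irr z dagD); apply: meek_arc.
move=> xA yA xy; have := yA; have := xA.
rewrite {1}(chain_component_connect _ compA yA) {1}(chain_component_connect _ compA xA).
move=> yx xy'; rewrite /undirected xy /=; apply/andP; split.
  by apply: contra (irr x) => /meek_connect; apply.
by apply: contra (irr y) => /meek_connect; apply.
Qed.

Lemma in_induced (x y : T) : ((x, y) \in DA) = ((val x, val y) \in D).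
Proof. by rewrite inE. Qed.

Lemma adjacent_induced (x y : T) : adjacent DA x y = adj (val x) (val y).
Proof. by rewrite /adjacent !in_induced. Qed.

Lemma chain_graphE (x y : T) : ((x, y) \in chain_graph D A) = adjacent DA x y.
Proof.
rewrite adjacent_induced inE essentialE; apply/idP/idP => [/and3P[]//|].
by apply: adj_undirected; apply: valP.
Qed.

Lemma induced_dag : is_dag DA.
Proof.
have [f fD] := dag_rank dagD; apply: (@rank_dag _ _ (f \o val)) => x y.
by rewrite in_induced => /fD.
Qed.

Lemma induced_moral : moral DA.
Proof.
move=> x y z; rewrite !in_induced adjacent_induced => xz yz nxy.
apply: contraT => nadj.
have : (val x, val z) \in meek.
  by apply: (@meek_vs _ _ (val y)); rewrite /v_structure xz yz (inj_eq val_inj) nxy.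
have xz_adj : adj (val x) (val z) by rewrite /adj /adjacent xz.
by have /and3P[_ /negbTE-> _] := adj_undirected (valP x) (valP z) xz_adj.
Qed.

Lemma chain_graph_connected (x y : T) : connect (arc (chain_graph D A)) x y.
Proof.
have := valP y; rewrite (chain_component_connect _ compA (valP x)) => /connectP[p].
elim: p x => [|z p IHp] x /=; first by move=> _ /val_inj->.
case/andP=> xz zp lst.
have zA : z \in A by rewrite (chain_component_connect _ compA (valP x)) connect1.
apply: connect_trans (IHp (Sub z zA) _ _); rewrite ?SubK //.
by apply: connect1; rewrite /arc /= inE essentialE.
Qed.

(** An arc entering [A] from outside is in [meek], since an undirected edge would put its tail in
    [A]. Hence it enters every node of [A], and outside parents do not spoil covering. *)
Lemma covered_induced (u v : T) : covered DA u v -> covered D (val u) (val v).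
Proof.
case=> uv cov; split; first by rewrite -in_induced.
have out x w w' : x \notin A -> w \in A -> w' \in A -> (x, w) \in D -> (x, w') \in D.
  move=> nxA wA w'A xw; apply: meek_arc; apply: (@meek_connect _ w); last first.
    by rewrite -(chain_component_connect _ compA wA).
  apply: contraR nxA => nxw; rewrite (chain_component_connect _ compA wA).
  apply: connect1; rewrite undirectedC /undirected nxw /adj /adjacent xw /=.
  by apply: contra (dag_asym dagD xw); apply: meek_arc.
move=> x nxu; have [xA|nxA] := boolP (x \in A).
  by have := cov (Sub x xA); rewrite !in_induced !SubK -(inj_eq val_inj) SubK; apply.
by apply/idP/idP; apply: out nxA (valP _) (valP _).
Qed.

End ChainComponent.
End EssentialGraphs.

(** * Clique trees *)

Section Trees.
Variables (T : finType).
Implicit Types (F : digraph T) (W : {set T}).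

Lemma is_treeP W F : reflect
  [/\ F \subset setX W W, forall x, (x, x) \notin F,
      forall x y, ((x, y) \in F) = ((y, x) \in F),
      forall x y, x \in W -> y \in W -> connect (arc F) x y
    & acyclic_undirected F] (is_tree W F).
Proof.
apply: (iffP and5P) => [[sub /forallP irr /forallP sym /forall_inP con acy]|
  [sub irr sym con acy]]; split=> //.
- by move=> x y; have /forallP/(_ y)/eqP := sym x.
- by move=> x y xW yW; have /forall_inP := con x xW; apply.
- exact/forallP.
- by apply/forallP=> x; apply/forallP=> y; rewrite sym.
- by apply/forall_inP=> x xW; apply/forall_inP=> y; apply: con.
Qed.

Lemma acyclic_size F c : acyclic_undirected F -> ucycle (arc F) c -> size c <= 2.
Proof.
move=> /forallP acy /andP[cyc unq].
have lec : size c < #|T|.+1 by rewrite ltnS -(card_uniqP unq) max_card.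
have /forallP/(_ (in_tuple c))/implyP := acy (Ordinal lec); apply.
by rewrite /ucycleb cyc unq.
Qed.

(** The node [z] is isolated instead of deleted, so [connect] stays on the same type. Away from [z],
    connectivity means lying in the same branch at [z]. *)
Definition avoid F (z : T) : rel T := [rel x y | [&& (x, y) \in F, x != z & y != z]].

Lemma avoid_path F z x p : path (arc F) x p -> z \notin x :: p ->
  connect (avoid F z) x (last x p).
Proof.
elim: p x => [|y p IHp] x /=; first by rewrite connect0.
case/andP=> xy yp; rewrite !inE !negb_or => /and3P[zx zy zp].
apply: connect_trans (IHp y yp _); last by rewrite inE negb_or zy.
by apply: connect1; apply/and3P; split; rewrite // eq_sym.
Qed.

Section Tree.
Variables (W : {set T}) (F : digraph T).
Hypothesis treeF : is_tree W F.

Lemma tree_sym x y : ((x, y) \in F) = ((y, x) \in F).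
Proof. by case/is_treeP: treeF. Qed.

Lemma tree_neq x y : (x, y) \in F -> x != y.
Proof. by apply: contraTneq => ->; case/is_treeP: treeF. Qed.

Lemma tree_ends x y : (x, y) \in F -> (x \in W) && (y \in W).
Proof. by case/is_treeP: treeF => /subsetP sub _ _ _ _ /sub; rewrite in_setX. Qed.

Lemma avoid_sym z : connect_sym (avoid F z).
Proof.
by apply: sym_connect_sym => x y; rewrite /avoid /= tree_sym; congr (_ && _); apply: andbC.
Qed.

(** Distinct neighbours of [x] joined away from [x] would close a cycle of length at least three
    through [x]. *)
Lemma tree_branch x a b y : (x, a) \in F -> (x, b) \in F ->
  connect (avoid F x) a y -> connect (avoid F x) b y -> a = b.
Proof.
move=> xa xb ay; rewrite avoid_sym => yb; have := connect_trans ay yb.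
case/connectP=> p0 /shortenP[p pth unq _] lst {p0}.
have /is_treeP[_ _ _ _ acy] := treeF.
have nx : x \notin a :: p.
  rewrite inE negb_or (tree_neq xa) /=; elim: p {unq lst} a pth {xa ay} => //= z p IHp a.
  by case/andP=> /and3P[_ _ nzx] /IHp; rewrite inE negb_or eq_sym nzx.
have pathF : path (arc F) a p by apply: sub_path pth => u v /and3P[].
have : ucycle (arc F) (x :: a :: p).
  by rewrite /ucycle /= rcons_path pathF -lst /arc /= xa tree_sym xb nx.
by move=> /(acyclic_size acy) /=; case: p lst {unq nx pathF pth}.
Qed.

Lemma tree_path x y : x \in W -> y \in W ->
  exists p, [/\ path (arc F) x p, last x p = y & uniq (x :: p)].
Proof.
move=> xW yW; have /is_treeP[_ _ _ /(_ x y xW yW) con _] := treeF.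
by case/connectP: con => p0 /shortenP[p pth unq _] ->; exists p.
Qed.

Lemma tree_first_step x y : x \in W -> y \in W -> x != y ->
  exists2 a, (x, a) \in F & connect (avoid F x) a y.
Proof.
move=> xW yW; have [[|a p] [pth <- unq]] := tree_path xW yW; first by rewrite eqxx.
move=> _; case/andP: pth => xa ap; exists a => //; apply: avoid_path => //.
by case/andP: unq.
Qed.

End Tree.
End Trees.

(** * Clique trees of intersection-incomparable graphs *)

Section CliqueTrees.
Variables (T : finType) (G D : digraph T).
Hypotheses (dagD : is_dag D) (moralD : moral D).
Hypothesis skelG : forall x y, ((x, y) \in G) = adjacent D x y.
Hypothesis connG : forall x y, connect (arc G) x y.
Hypothesis incG : intersection_incomparable G.
Implicit Types (B C P : {set T}) (F : digraph {set T}).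

Local Notation Q := (max_cliques G).
Local Notation GG := (clique_graph G).

Lemma is_cliqueP C : reflect (clique_in D C) (is_clique G C).
Proof.
apply: (iffP forall_inP) => [cliC x y xC yC nxy|cliC x xC].
  by have /forall_inP/(_ y yC)/implyP/(_ nxy) := cliC x xC; rewrite skelG.
by apply/forall_inP=> y yC; apply/implyP=> nxy; rewrite skelG; apply: cliC.
Qed.

Lemma max_clique_clique C : C \in Q -> clique_in D C.
Proof. by rewrite inE => /maxsetp/is_cliqueP. Qed.

Lemma max_clique_eq C1 C2 : C1 \in Q -> C2 \in Q -> C1 \subset C2 -> C1 = C2.
Proof.
rewrite !inE => max1 /maxsetp cli2 sub.
by case/maxsetP: max1 => _ /(_ C2 cli2 sub).
Qed.

Lemma max_clique_diff C1 C2 : C1 \in Q -> C2 \in Q -> C1 != C2 ->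
  exists2 x, x \in C1 & x \notin C2.
Proof.
by move=> C1Q C2Q /eqP ne; apply/subsetPn/negP=> /(max_clique_eq C1Q C2Q).
Qed.

Lemma adjacent_clique x y : adjacent D x y ->
  exists2 C, C \in Q & (x \in C) && (y \in C).
Proof.
move=> xy; have : is_clique G [set x; y].
  apply/is_cliqueP=> a b; rewrite !inE.
  by case/orP=> /eqP-> /orP[] /eqP->; rewrite ?eqxx // adjacentC.
case/maxset_exists=> C maxC /subsetP sub; exists C; first by rewrite inE.
by rewrite !sub // !inE eqxx ?orbT.
Qed.

Section CliqueTree.
Variable F : digraph {set T}.
Hypothesis ctF : is_clique_tree G F.

Lemma clique_tree_tree : is_tree Q F.
Proof. by case/andP: ctF. Qed.

Lemma clique_tree_path v C C' : C \in Q -> C' \in Q -> v \in C -> v \in C' ->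
  exists p, [/\ path (arc F) C p, last C p = C', uniq (C :: p)
               & all (fun B : {set T} => v \in B) (C :: p)].
Proof.
move=> CQ C'Q vC vC'; have /andP[_ /forallP/(_ v) treev] := ctF.
have Cv B : B \in Q -> v \in B -> B \in [set B in Q | v \in B].
  by move=> BQ vB; apply/setIdP.
have [p [pth lst unq]] := tree_path treev (Cv C CQ vC) (Cv C' C'Q vC').
exists p; split=> //=.
  by apply: sub_path pth => A B; rewrite /arc /= inE => /andP[].
rewrite vC /=; apply/allP=> B Bp; case/splitPr: Bp pth => p1 p2.
by rewrite cat_path /= => /and3P[_ + _]; rewrite /arc /= !inE => /and3P[_ _ /andP[]].
Qed.

Lemma clique_tree_first_step v C C' : C \in Q -> C' \in Q -> v \in C -> v \in C' ->
  C != C' -> exists a, [/\ (C, a) \in F, v \in a & connect (avoid F C) a C'].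
Proof.
move=> CQ C'Q vC vC'; have [[|a p]] := clique_tree_path CQ C'Q vC vC'.
  by case=> _ /= -> _ _ /eqP.
case=> /andP[Ca ap] <- /andP[nC _] /and3P[_ va _] _.
by exists a; split=> //; apply: avoid_path.
Qed.

Lemma clique_tree_avoid v B C C' : C \in Q -> C' \in Q -> v \in C -> v \in C' ->
  v \notin B -> connect (avoid F B) C C'.
Proof.
move=> CQ C'Q vC vC' nvB; have [p [pth <- _ /allP allp]] := clique_tree_path CQ C'Q vC vC'.
by apply: avoid_path => //; apply: contra nvB => /allp.
Qed.

(** A clique containing both nodes would lie, seen from [C1], on the side of [C2] because of [y] and
    on the side of a neighbour containing [x]; so [x] would be in [C2]. *)
Lemma clique_tree_separates C1 C2 x y : (C1, C2) \in F ->
  x \in C1 -> x \notin C2 -> y \in C2 -> y \notin C1 -> ~~ adjacent D x y.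
Proof.
move=> C12 xC1 nxC2 yC2 nyC1; have tree := clique_tree_tree.
have /andP[C1Q C2Q] := tree_ends tree C12.
apply/negP=> /adjacent_clique[C3 C3Q /andP[xC3 yC3]].
have [|a [C1a xa aC3]] := clique_tree_first_step C1Q C3Q xC1 xC3.
  by apply: contraNneq nyC1 => ->.
have := clique_tree_avoid C2Q C3Q yC2 yC3 nyC1.
move/(tree_branch tree C1a C12 aC3) => aC2.
by rewrite aC2 (negbTE nxC2) in xa.
Qed.

Lemma sub_clique_graph : F \subset GG.
Proof. exact: bigcup_sup. Qed.

(** Suppose another clique tree has an edge from [C1] to [C2], and [F] reaches [C2] through a
    different neighbour [a]. By the subtree property [a] contains the intersection of [C1] and [C2],
    which makes two edges of the clique graph comparable. *)
Lemma clique_graph_tree : GG = F.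
Proof.
apply/eqP; rewrite eqEsubset sub_clique_graph andbT.
apply/bigcupsP=> F' ctF'; apply/subsetP=> [[C1 C2]] C12.
have tree := clique_tree_tree.
have tree' : is_tree Q F' by case/andP: ctF'.
have /andP[C1Q C2Q] := tree_ends tree' C12; have nC12 := tree_neq tree' C12.
have [a C1a aC2] := tree_first_step tree C1Q C2Q nC12.
have [<- //|naC2] := eqVneq a C2.
have C21G : (C2, C1) \in GG.
  by apply/bigcupP; exists F' => //; rewrite (tree_sym tree').
have C1aG : (C1, a) \in GG by apply: (subsetP sub_clique_graph).
have /andP[/negP[]] : incomparable C2 C1 a by apply: incG; rewrite 1?eq_sym.
apply/subsetP=> v /setIP[vC2 vC1]; rewrite inE vC1.
have [a' [C1a' va' a'C2]] := clique_tree_first_step C1Q C2Q vC1 vC2 nC12.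
by rewrite (tree_branch tree C1a C1a' aC2 a'C2).
Qed.

End CliqueTree.

(** By [clique_graph_tree] this holds as soon as some clique tree exists. *)
Hypothesis ctG : is_clique_tree G GG.
Let treeG := clique_tree_tree ctG.

(** * Arrowheads on the clique graph *)

Lemma arrowheadP C1 C2 : reflect
  (forall v w, v \in C1 -> v \in C2 -> w \in C2 -> w \notin C1 -> (v, w) \in D)
  (arrowhead D C1 C2).
Proof.
apply: (iffP forall_inP) => [ah v w v1 v2 w2 w1|ah v /setIP[v1 v2]].
  have vI : v \in C1 :&: C2 by rewrite inE v1.
  by have /forall_inP := ah v vI; apply; rewrite inE w1.
by apply/forall_inP=> w /setDP[w2 w1]; apply: ah.
Qed.

Lemma GGsym C1 C2 : ((C1, C2) \in GG) = ((C2, C1) \in GG).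
Proof. exact: tree_sym treeG _ _. Qed.

(** A missing arrowhead at [C2] gives an arc [u -> v] from outside [C1] into the intersection. A
    node [w] of [C1] outside [C2] is not adjacent to [u], hence shares no child with it; but
    [w -> v'] in [C1] would make [v'] or [v] such a child. *)
Lemma arrowhead_total C1 C2 : (C1, C2) \in GG -> ~~ arrowhead D C1 C2 ->
  arrowhead D C2 C1.
Proof.
move=> C12; have /andP[C1Q C2Q] := tree_ends treeG C12.
rewrite negb_forall_in => /exists_inP[v /setIP[vC1 vC2]].
rewrite negb_forall_in => /exists_inP[u /setDP[uC2 nuC1] nvu].
have sep w : w \in C1 -> w \notin C2 -> ~~ adjacent D w u.
  by move=> wC1 nwC2; apply: (clique_tree_separates ctG C12).
have ne (A : {set T}) z w : z \in A -> w \notin A -> z != w.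
  by move=> zA; apply: contraNneq => <-.
have cli1 := max_clique_clique C1Q; have cli2 := max_clique_clique C2Q.
have uv : (u, v) \in D.
  by have := cli2 _ _ vC2 uC2 (ne _ _ _ vC1 nuC1); rewrite /adjacent (negbTE nvu).
have no_into w z : w \in C1 -> w \notin C2 -> (u, z) \in D -> (w, z) \notin D.
  move=> wC1 nwC2 uz; apply/negP=> wz; case/negP: (sep w wC1 nwC2).
  by apply: moralD wz uz (ne _ _ _ wC1 nuC1).
apply/arrowheadP=> v' w v'C2 v'C1 wC1 nwC2.
have /orP[//|wv'] := cli1 _ _ v'C1 wC1 (ne _ _ _ v'C2 nwC2).
have [v'v|nv'v] := eqVneq v' v; first by have := no_into w v wC1 nwC2 uv; rewrite -v'v wv'.
have /orP[v'u|uv'] := cli2 _ _ v'C2 uC2 (ne _ _ _ v'C1 nuC1); last first.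
  by have := no_into w v' wC1 nwC2 uv'; rewrite wv'.
have v'v := dag_trans dagD v'u uv (cli1 _ _ v'C1 vC1 nv'v).
have wv : (w, v) \in D.
  by apply: (dag_trans dagD wv' v'v); apply: cli1 => //; rewrite eq_sym (ne _ _ _ vC2).
by have := no_into w v wC1 nwC2 uv; rewrite wv.
Qed.

(** Incomparability gives a node of [C] in [C1] only and one in [C2] only; two arrowheads would
    orient the edge between them both ways. *)
Lemma arrowhead_unique C1 C2 C : (C1, C) \in GG -> (C2, C) \in GG ->
  arrowhead D C1 C -> arrowhead D C2 C -> C1 = C2.
Proof.
move=> C1C C2C /arrowheadP ah1 /arrowheadP ah2; apply: contraTeq isT => ne.
have /andP[/subsetPn[v]] : incomparable C1 C C2 by apply: incG; rewrite // GGsym.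
rewrite !inE => /andP[vC1 vC]; rewrite vC /= => nvC2 /subsetPn[u].
rewrite !inE => /andP[uC uC2]; rewrite uC andbT => nuC1.
by have := dag_asym dagD (ah1 v u vC1 vC uC nuC1); rewrite ah2.
Qed.

Lemma points_toW C1 C2 : points_to D C1 C2 -> arrowhead D C1 C2.
Proof. by case/andP. Qed.

Lemma arrowhead_next C1 C C2 : (C1, C) \in GG -> arrowhead D C1 C ->
  (C, C2) \in GG -> C2 != C1 -> points_to D C C2.
Proof.
move=> C1C ah1 CC2 ne.
have nah : ~~ arrowhead D C2 C.
  by apply: contra ne => ah2; apply/eqP/(arrowhead_unique _ C1C ah2 ah1); rewrite GGsym.
by rewrite /points_to nah arrowhead_total // GGsym.
Qed.

(** If [x] were in [C], the arrowhead there would force [u -> x]. The next edge of the path has an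
    arrowhead ahead again, so the argument repeats. *)
Lemma arrowhead_path_avoids x u P C s : (x, u) \in D -> x \notin P ->
  (P, C) \in GG -> arrowhead D P C -> path (arc GG) C s -> uniq (P :: C :: s) ->
  all (fun B : {set T} => u \in B) (P :: C :: s) -> x \notin last C s.
Proof.
move=> xu; elim: s P C => [|B s IHs] P C nxP PC ahPC.
  move=> _ _ /and3P[uP uC _]; apply: contraNN (dag_asym dagD xu) => xC.
  by move/arrowheadP: ahPC; apply.
move=> /= /andP[CB Bs] /and3P[nP nC unq] /and4P[uP uC uB us].
have nxC : x \notin C.
  by apply: contraNN (dag_asym dagD xu) => xC; move/arrowheadP: ahPC; apply.
apply: (IHs C) => //; last by rewrite /= uC uB.
apply/points_toW/(arrowhead_next PC) => //.
by apply: contraNneq nP => <-; rewrite !inE eqxx orbT.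
by rewrite /= nC.
Qed.

(** The parent is the first step from [C] towards a clique containing both [x] and [u]: were there
    an arrowhead away from [C], the path would never reach [x]. *)
Lemma outer_parent C x u : C \in Q -> u \in C -> (x, u) \in D -> x \notin C ->
  exists P, [/\ (P, C) \in GG, points_to D P C & u \in P].
Proof.
move=> CQ uC xu nxC; have [|B BQ /andP[xB uB]] := @adjacent_clique x u.
  by rewrite /adjacent xu.
have [[|P s]] := clique_tree_path ctG CQ BQ uC uB.
  by case=> _ /= CB; rewrite CB xB in nxC.
case=> /andP[CP Ps] lst unq us; have uP : u \in P by case/and3P: us.
have nahCP : ~~ arrowhead D C P.
  apply: contraL xB => ah; rewrite -lst.
  exact: (arrowhead_path_avoids xu nxC CP ah Ps unq us).
exists P; split=> //; first by rewrite GGsym.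
by rewrite /points_to nahCP arrowhead_total.
Qed.

(** Makes [C :\: P] a module for [module_half]. A parent outside [C] would come through a second
    arrowhead into [C], and one in [P] points to all of [C :\: P]. *)
Lemma child_module P C x u v : (P, C) \in GG -> arrowhead D P C ->
  x \notin C :\: P -> u \in C :\: P -> v \in C :\: P -> (x, u) \in D -> (x, v) \in D.
Proof.
move=> PC ah + /setDP[uC nuP] /setDP[vC nvP] xu.
have /andP[_ CQ] := tree_ends treeG PC.
have [xC|nxC] := boolP (x \in C); last first.
  have [P' [P'C /points_toW ah' uP']] := outer_parent CQ uC xu nxC.
  by rewrite (arrowhead_unique P'C PC ah' ah) (negbTE nuP) in uP'.
rewrite inE xC andbT negbK => xP; by move/arrowheadP: ah; apply.
Qed.

Lemma root_closed C x u : C \in Q ->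
  (forall P, (P, C) \in GG -> ~~ points_to D P C) -> u \in C -> (x, u) \in D -> x \in C.
Proof.
move=> CQ root uC xu; apply: contraT => nxC.
have [P [PC pt _]] := outer_parent CQ uC xu nxC.
by have := root P PC; rewrite pt.
Qed.

(** An empty intersection is comparable with any other, so [C1] and [C2] would be the only maximal
    cliques. Then no edge of [G] leaves [C1], against connectivity. *)
Lemma clique_graph_meet C1 C2 : (C1, C2) \in GG -> C1 :&: C2 != set0.
Proof.
move=> C12; have /andP[C1Q C2Q] := tree_ends treeG C12; have ne := tree_neq treeG C12.
apply/negP=> /eqP meet0.
have nbr B : (C1, B) \in GG -> B = C2.
  move=> C1B; apply: contraTeq isT => nB.
  have /andP[] : incomparable C2 C1 B by apply: incG; rewrite // 1?GGsym 1?eq_sym.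
  by rewrite setIC meet0 sub0set.
have nbr' B : (C2, B) \in GG -> B = C1.
  move=> C2B; apply: contraTeq isT => nB.
  have /andP[] : incomparable C1 C2 B by apply: incG; rewrite // 1?eq_sym.
  by rewrite meet0 sub0set.
have two B : B \in Q -> B = C1 \/ B = C2.
  move=> BQ; have [p [pth <- _]] := tree_path treeG C1Q BQ.
  have gen C : C = C1 \/ C = C2 -> path (arc GG) C p -> last C p = C1 \/ last C p = C2.
    elim: p C {pth} => [//|A p IHp] C /= CC /andP[CA]; apply: IHp.
    by case: CC CA => -> CA; [right; apply: nbr | left; apply: nbr'].
  by apply: gen => //; left.
have [v vC1 nvC2] := max_clique_diff C1Q C2Q ne.
have [|u uC2 nuC1] := max_clique_diff C2Q C1Q; first by rewrite eq_sym.
case/negP: nuC1; case/connectP: (connG v u) => p.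
elim: p v vC1 {nvC2} => [|w p IHp] v vC1 /=; first by move=> _ ->.
case/andP; rewrite /arc /= skelG => /adjacent_clique[C3 C3Q /andP[vC3 wC3]]; apply: IHp.
case: (two C3 C3Q) => E; first by rewrite -E.
by have /setP/(_ v) := meet0; rewrite !inE vC1 -E vC3.
Qed.

End CliqueTrees.

(** * Residuals *)

Section Residuals.
Variables (T : finType) (G D : digraph T).
Hypotheses (dagD : is_dag D) (moralD : moral D).
Hypothesis skelG : forall x y, ((x, y) \in G) = adjacent D x y.
Hypothesis connG : forall x y, connect (arc G) x y.
Hypothesis incG : intersection_incomparable G.

Local Notation Q := (max_cliques G).
Local Notation GG := (clique_graph G).

Hypothesis ctG : is_clique_tree G GG.
Implicit Types (C P : {set T}) (B : {set {set T}}).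

Let treeG : is_tree Q GG := clique_tree_tree ctG.
Let GGsymG : forall C1 C2, ((C1, C2) \in GG) = ((C2, C1) \in GG) := GGsym ctG.

Definition bidirected : digraph {set T} :=
  [set e in GG | ~~ points_to D e.1 e.2 & ~~ points_to D e.2 e.1].

Local Notation comp C := [set C' | connect (arc bidirected) C C'].
Local Notation comps := (bidirected_components G D GG).

Lemma bidirectedP C1 C2 : reflect
  [/\ (C1, C2) \in GG, arrowhead D C1 C2 & arrowhead D C2 C1] ((C1, C2) \in bidirected).
Proof.
rewrite inE /points_to /=; apply: (iffP and3P) => [[C12 n12 n21]|[-> -> ->]] //.
have tot := arrowhead_total dagD moralD skelG ctG C12.
by move: n12 n21 tot; case: (arrowhead D C1 C2); case: (arrowhead D C2 C1) => //= _ _ /(_ isT).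
Qed.

Lemma bidirected_sym C1 C2 : ((C1, C2) \in bidirected) = ((C2, C1) \in bidirected).
Proof. by apply/bidirectedP/bidirectedP => [][+ a1 a2]; rewrite GGsymG. Qed.

Lemma bidirected_unique C C1 P : (C, C1) \in bidirected -> (P, C) \in GG ->
  arrowhead D P C -> P = C1.
Proof.
case/bidirectedP=> CC1 _ ah PC ahP.
by apply: (arrowhead_unique dagD incG ctG PC _ ahP ah); rewrite GGsymG.
Qed.

Lemma bidirected_root C C1 P : (C, C1) \in bidirected -> (P, C) \in GG ->
  ~~ points_to D P C.
Proof.
move=> bid PC; apply/negP=> /andP[ah]; rewrite (bidirected_unique bid PC ah).
by case/bidirectedP: bid => _ ->.
Qed.

Lemma comp_single C : (forall C', (C, C') \notin bidirected) -> comp C = [set C].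
Proof.
move=> nbid; apply/setP=> C'; rewrite !inE; apply/connectP/eqP => [[[|A p]]|->] //=.
- by case/andP=> CA; have := nbid A; rewrite [_ \in _]CA.
- by exists [::].
Qed.

(** Bidirected edges form a matching, because each clique receives at most one arrowhead. *)
Lemma comp_pair C C1 : (C, C1) \in bidirected -> comp C = [set C; C1].
Proof.
move=> bid; apply/setP=> C'; rewrite !inE; apply/idP/orP; last first.
  by case=> /eqP->; rewrite ?connect0 ?connect1.
have nbr A A1 A2 : (A, A1) \in bidirected -> (A, A2) \in bidirected -> A2 = A1.
  by move=> b1 /bidirectedP[AA2 _ ah]; apply: (bidirected_unique b1) => //; rewrite GGsymG.
have gen A p : A = C \/ A = C1 -> path (arc bidirected) A p ->
    last A p = C \/ last A p = C1.
  elim: p A => [//|A' p IHp] A /= AC /andP[AA']; apply: IHp.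
  case: AC AA' => -> bid'; first by right; apply: nbr bid'.
  by left; apply: nbr bid'; rewrite bidirected_sym.
by case/connectP=> p pth ->; case: (gen C p) => //; [left | move=> -> | move=> ->]; auto.
Qed.

Lemma bidirected_csym : connect_sym (arc bidirected).
Proof. by apply: sym_connect_sym => C1 C2; apply: bidirected_sym. Qed.

Lemma compsP B C : B \in comps -> C \in B -> B = comp C /\ C \in Q.
Proof.
case/imsetP=> C0 C0Q -> ; rewrite inE => C0C; split.
  by apply/setP=> A; rewrite !inE; apply: (same_connect bidirected_csym C0C).
case/connectP: C0C => p pth ->.
elim: p C0 C0Q pth => //= A p IHp C0 C0Q /andP[/bidirectedP[C0A _ _]]; apply: IHp.
by have /andP[] := tree_ends treeG C0A.
Qed.

Lemma in_residual B v : v \in residual G D GG B -> exists2 C, C \in B & v \in C.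
Proof. by case/setDP=> /bigcupP[C CB vC] _; exists C. Qed.

Lemma residual_not_parent B v C P : v \in residual G D GG B -> C \in B ->
  (P, C) \in GG -> points_to D P C -> v \notin P.
Proof.
case/setDP=> _ + CB PC pt; apply: contra => vP.
have /andP[PQ _] := tree_ends treeG PC.
apply/bigcupP; exists (comp P); last first.
  by apply/bigcupP; exists P => //; rewrite inE connect0.
rewrite inE; apply/andP; split; first by apply/imsetP; exists P.
apply/exists_inP; exists P; first by rewrite inE connect0.
by apply/exists_inP; exists C; rewrite ?PC.
Qed.

Lemma points_to_path P C s : (P, C) \in GG -> points_to D P C ->
  path (arc GG) C s -> uniq (P :: C :: s) ->
  exists P', [/\ P' \in P :: C :: s, (P', last C s) \in GG & points_to D P' (last C s)].
Proof.
elim: s P C => [|A s IHs] P C PC pt; first by exists P; rewrite inE eqxx.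
move=> /= /andP[CA As] /and3P[nP nC unq].
have ptCA : points_to D C A.
  apply: (arrowhead_next dagD moralD skelG incG ctG PC (points_toW pt)) => //.
  by apply: contraNneq nP => <-; rewrite !inE eqxx orbT.
have [|P' [P'in edge ptP']] := IHs C A CA ptCA As; first by rewrite /= nC.
by exists P'; rewrite inE P'in orbT.
Qed.

(** Follow a path of cliques containing [v]. An edge pointing back puts [v] in a parent of [B1]; an
    edge pointing ahead makes the rest of the path descend, which puts [v] in a parent of [B2]. So
    all edges are bidirected. *)
Lemma residual_disjoint B1 B2 v : B1 \in comps -> B2 \in comps ->
  v \in residual G D GG B1 -> v \in residual G D GG B2 -> B1 = B2.
Proof.
move=> cB1 cB2 v1 v2.
have [C1 C1B vC1] := in_residual v1; have [C2 C2B vC2] := in_residual v2.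
have [_ C1Q] := compsP cB1 C1B; have [eqB2 C2Q] := compsP cB2 C2B.
suff C2B1 : C2 \in B1 by rewrite eqB2; have [] := compsP cB1 C2B1.
have [p [pth lst unq allv]] := clique_tree_path ctG C1Q C2Q vC1 vC2.
elim: p C1 C1B pth lst unq allv {vC1 C1Q} => [|A p IHp] C CB /=.
  by move=> _ <-.
move=> /andP[CA0 Ap] lst /andP[nC unq] /and3P[vC vA allv].
have CA : (C, A) \in GG by [].
have [ptCA|nptCA] := boolP (points_to D C A).
  have [|P [Pin PC2 ptP]] := points_to_path CA ptCA Ap; first by rewrite /= nC.
  rewrite lst in PC2 ptP; have := residual_not_parent v2 C2B PC2 ptP.
  have /allP/(_ P Pin) -> // : all (fun C => v \in C) [:: C, A & p].
  by rewrite /= vC vA.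
have [ptAC|nptAC] := boolP (points_to D A C).
  by have := residual_not_parent v1 CB _ ptAC; rewrite vA GGsymG CA => /(_ isT).
apply: (IHp A); rewrite //= ?vA //; have [-> _] := compsP cB1 CB.
by rewrite inE connect1 // /arc /= inE CA nptCA.
Qed.

Lemma cdct_parentsP B B' : B' \in cdct_parents G D GG B -> exists P C,
  [/\ B' = comp P, P \in Q, C \in B, (P, C) \in GG & points_to D P C].
Proof.
rewrite inE => /andP[cB' /exists_inP[P PB' /exists_inP[C CB /andP[PC pt]]]].
by have [eqB PQ] := compsP cB' PB'; exists P, C.
Qed.

Lemma residual_root B : (forall P C, C \in B -> (P, C) \in GG -> ~~ points_to D P C) ->
  residual G D GG B = cover B.
Proof.
move=> root; rewrite /residual big1 ?setD0 // => B' /cdct_parentsP[P [C [_ _ CB PC]]].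
by rewrite (negbTE (root P C CB PC)).
Qed.

(** The parent component may contain a second clique [P2], but [P] separates it from [C], so it
    removes nothing more from [C]. *)
Lemma residual_child P C : (forall C', (C, C') \notin bidirected) ->
  (P, C) \in GG -> points_to D P C -> residual G D GG [set C] = C :\: P.
Proof.
move=> nbid PC pt; have ahPC := points_toW pt; have /andP[PQ CQ] := tree_ends treeG PC.
apply/eqP; rewrite eqEsubset; apply/andP; split; apply/subsetP=> v.
  move=> vR; rewrite inE (residual_not_parent vR _ PC pt) ?set11 //.
  by have [C' /set1P-> ->] := in_residual vR.
case/setDP=> vC nvP; rewrite inE; apply/andP; split; last by rewrite /cover big_set1.
apply/negP=> /bigcupP[B' /cdct_parentsP[P' [C' [-> _ /set1P-> P'C /points_toW ah]]]].
rewrite (arrowhead_unique dagD incG ctG P'C PC ah ahPC) => /bigcupP[C3 + vC3].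
case: (pickP [pred P2 | (P, P2) \in bidirected]) => [P2 /= bid|nbidP]; last first.
  rewrite comp_single => [/set1P E|P2]; first by rewrite E (negbTE nvP) in vC3.
  by have /= -> := nbidP P2.
rewrite (comp_pair bid) !inE => /orP[] /eqP E; first by rewrite E (negbTE nvP) in vC3.
rewrite E in vC3; have [PP2 _ _] := bidirectedP _ _ bid.
have /andP[_ P2Q] := tree_ends treeG PP2.
have CP2 : C != P2.
  by apply: contraTneq bid => <-; rewrite bidirected_sym; apply: nbid.
have [a [Ca va aP2]] := clique_tree_first_step ctG CQ P2Q vC vC3 CP2.
have PP2' : connect (avoid GG C) P P2.
  apply: connect1; rewrite /avoid /= PP2 (tree_neq treeG PC) /=.
  by rewrite eq_sym.
rewrite GGsymG in PC; have aP := tree_branch treeG Ca PC aP2 PP2'.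
by rewrite aP (negbTE nvP) in va.
Qed.

Lemma clique_in_sub C P : clique_in D C -> P \subset C -> clique_in D P.
Proof. by move=> cli /subsetP sub x y /sub xC /sub yC; apply: cli. Qed.

(* Otherwise the arc from the last node of C :&: C1 to the first node of
   C :\: C1 would be covered, and flipping it destroys an arrowhead. *)
Lemma determined_bidirected h C C1 : (C, C1) \in bidirected ->
  determined D h (C, C1) -> performed h :&: (C :|: C1) != set0.
Proof.
move=> bid det; have [CC1 ah ah1] := bidirectedP _ _ bid; have [f fD] := dag_rank dagD.
have /andP[CQ C1Q] := tree_ends treeG CC1.
have clo x u : u \in C -> (x, u) \in D -> x \in C.
  apply: (root_closed dagD moralD skelG incG ctG CQ) => P.
  exact: bidirected_root bid.
have [s] := max_rank f (clique_graph_meet skelG connG incG ctG CC1).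
case/setIP=> sC sC1 max_s.
have [r0 r0C nr0C1] := max_clique_diff CQ C1Q (tree_neq treeG CC1).
have r0D : r0 \in C :\: C1 by rewrite inE nr0C1.
case: (arg_minnP f r0D) => r /setDP[rC nrC1] min_r.
have to_r v : v \in C -> v \in C1 -> (v, r) \in D.
  by move=> vC vC1; apply: (arrowheadP _ _ _ ah1).
have nsr : s != r by apply: contraTneq sC1 => ->.
have cov : covered D s r.
  split; first exact: to_r.
  move=> x nxs; apply/idP/idP => [xr|xs].
    have xC := clo _ _ rC xr; have xC1 : x \in C1.
      apply: contraTT (fD _ _ xr) => nxC1; rewrite -leqNgt.
      by apply: min_r; apply/setDP.
    have /orP[//|/fD] := max_clique_clique skelG CQ xC sC nxs.
    by rewrite ltnNge max_s // inE xC.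
  have xC := clo _ _ sC xs; apply: to_r => //; apply: contraTT xs => nxC1.
  by apply: (dag_asym dagD); apply: (arrowheadP _ _ _ ah1).
apply/negP=> /eqP meet0.
have out x : x \in C -> x \notin performed h.
  move=> xC; apply/negP=> xh; have /setP/(_ x) := meet0.
  by rewrite !inE xC andbT; rewrite inE in xh; rewrite xh.
have fl := flip_interventional_MEC dagD cov (out s sC) (out r rC).
have /forall_inP/(_ _ fl)/andP[_ /eqP] := det; rewrite /= ah1 => /arrowheadP/(_ s r).
rewrite sC sC1 rC nrC1 in_flip !eqxx (negbTE nsr) /=.
by move=> /(_ isT isT isT isT).
Qed.

Variable X : {set T}.
Hypothesis hitX : covered_hit D X.

(** The [+ 1] costs nothing later, as the last fresh node of a residual is oriented by the
    others. *)
Lemma residual_bound B I : B \in comps ->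
  (forall C C1, (C, C1) \in bidirected -> I :&: (C :|: C1) != set0) ->
  #|residual G D GG B :\: I| <= 2 * #|X :&: residual G D GG B| + 1.
Proof.
move=> cB hitI; have [C CB] : exists C, C \in B.
  by case/imsetP: (cB) => C _ ->; exists C; rewrite inE connect0.
have [eqB CQ] := compsP cB CB; rewrite eqB.
have cliQ A := @max_clique_clique _ _ _ skelG A.
have le (R : {set T}) : #|R| <= 2 * #|X :&: R| + 1 -> #|R :\: I| <= 2 * #|X :&: R| + 1.
  by apply: leq_trans; apply/subset_leq_card/subsetDl.
have root_half A : A \in Q -> (forall P, (P, A) \in GG -> ~~ points_to D P A) ->
    #|A| <= 2 * #|X :&: A| + 1.
  move=> AQ root; apply: (module_half dagD hitX); first exact: cliQ.
  move=> x u v nx uA vA xu; case/negP: nx.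
  exact: (root_closed dagD moralD skelG incG ctG AQ root uA xu).
have child_half P A : (P, A) \in GG -> arrowhead D P A ->
    #|A :\: P| <= 2 * #|X :&: (A :\: P)| + 1.
  move=> PA ah; apply: (module_half dagD hitX).
    by apply: (clique_in_sub _ (subsetDl _ _)); apply: cliQ; case/andP: (tree_ends treeG PA).
  by move=> x u v; apply: (child_module dagD moralD skelG incG ctG PA ah).
case: (pickP [pred C1 | (C, C1) \in bidirected]) => [C1 /= bid|nbid0]; last first.
  have nbid C1 : (C, C1) \notin bidirected by have /= -> := nbid0 C1.
  rewrite comp_single //; case: (pickP [pred P | ((P, C) \in GG) && points_to D P C]).
    move=> P /= /andP[PC pt]; rewrite (residual_child nbid PC pt).
    by apply/le/child_half/points_toW.
  move=> root; have root' P : (P, C) \in GG -> ~~ points_to D P C.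
    by move=> PC; have := root P; rewrite /= PC /= => ->.
  rewrite residual_root /cover ?big_set1; first by apply/le/root_half.
  by move=> P C' /set1P->; apply: root'.
have [CC1 ah ah1] := bidirectedP _ _ bid; have /andP[_ C1Q] := tree_ends treeG CC1.
have rootC P : (P, C) \in GG -> ~~ points_to D P C by apply: bidirected_root bid.
have rootC1 P : (P, C1) \in GG -> ~~ points_to D P C1.
  by apply: (@bidirected_root _ C); rewrite bidirected_sym.
rewrite (comp_pair bid) residual_root; last first.
  by move=> P C' /set2P[] ->; [apply: rootC | apply: rootC1].
have -> : cover [set C; C1] = C :|: C1.
  by rewrite /cover bigcup_setU !big_set1.
(* The union splits into the modules [C] and [C1 :\: C]. Each loses one to rounding, and the node of
   [I] given by [hitI] makes up for one of them. *)
have h1 := root_half C CQ rootC; have h2 := child_half C C1 CC1 ah.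
have eqU : C :|: C1 = C :|: (C1 :\: C) by apply/setP=> x; rewrite !inE; case: (x \in C).
have cardU (Y : {set T}) : #|Y :&: (C :|: C1)| = #|Y :&: C| + #|Y :&: (C1 :\: C)|.
  rewrite eqU setIUr cardsU [X in _ - #|pred_of_set X|](_ : _ = set0) ?cards0 ?subn0 //.
  by apply/setP=> x; rewrite !inE; case: (x \in C); rewrite ?andbF.
have := cardU setT; rewrite !setTI cardU => eqC.
have hI := hitI _ _ bid; rewrite setIC -card_gt0 in hI.
rewrite cardsD; lia.
Qed.

End Residuals.

Lemma sum_disjoint_le (T I : finType) (X : {set T}) (P : {set I}) (f : I -> {set T}) :
  (forall i j x, i \in P -> j \in P -> x \in f i -> x \in f j -> i = j) ->
  \sum_(i in P) #|X :&: f i| <= #|X|.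
Proof.
move=> disj.
have card_sum (S : finType) (A B : {set S}) : #|A :&: B| = \sum_(x in A) (x \in B).
  rewrite -sum1_card big_mkcond [RHS]big_mkcond; apply: eq_bigr => x _.
  by rewrite inE; case: (x \in A); case: (x \in B).
rewrite (eq_bigr _ (fun i _ => card_sum _ _ _)) exchange_big /= -sum1_card.
apply: leq_sum => x _; have -> : \sum_(i in P) (x \in f i) = #|P :&: [set i | x \in f i]|.
  by rewrite card_sum; apply: eq_bigr => i _; rewrite inE.
rewrite leqNgt; apply/negP=> /card_gt1P[i [j [/setIP[iP +] /setIP[jP +] /eqP]]].
by rewrite !inE => xi xj; apply; apply: disj xi xj.
Qed.

(** * Runs of the policy *)

Lemma fixset_min (I : finType) (F : {set I} -> {set I}) (M : {set I}) :
  {homo F : A B / A \subset B} -> F M \subset M -> fixset F \subset M.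
Proof.
move=> monoF FM; rewrite /fixset; elim: #|_| => [|n IHn]; first by rewrite sub0set.
exact: subset_trans (monoF _ _ IHn) FM.
Qed.

Section Runs.
Variables (T : finType) (G D : digraph T).
Hypotheses (dagD : is_dag D) (moralD : moral D).
Hypothesis skelG : forall x y, ((x, y) \in G) = adjacent D x y.
Hypothesis connG : forall x y, connect (arc G) x y.
Hypothesis incG : intersection_incomparable G.

Local Notation Q := (max_cliques G).
Local Notation GG := (clique_graph G).

Hypothesis ctG : is_clique_tree G GG.
Implicit Types (C P : {set T}) (h : seq T) (K F : digraph {set T}) (S : {set {set T}}).

Let treeG : is_tree Q GG := clique_tree_tree ctG.
Let GGsymG : forall C1 C2, ((C1, C2) \in GG) = ((C2, C1) \in GG) := GGsym ctG.

Local Notation bid := (bidirected G D).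
Local Notation comps := (bidirected_components G D GG).

(** Directed edges may become known by propagation alone. Only for bidirected ones does phase 2 need
    that the interventions determine the marks. *)
Definition known_sound h K :=
  K \subset [set e in GG | (e \in bid) ==> determined D h e].

Lemma known_soundP h K C C1 : known_sound h K -> (C, C1) \in K ->
  (C, C1) \in bid -> determined D h (C, C1).
Proof. by move=> /subsetP sound /sound /setIdP[_ /implyP]. Qed.

Lemma performed_rcons h v : performed h \subset performed (rcons h v).
Proof. by apply/subsetP=> x; rewrite !inE mem_rcons inE => ->; rewrite orbT. Qed.

Lemma determined_rcons h v e : determined D h e -> determined D (rcons h v) e.
Proof.
move=> /forall_inP det; apply/forall_inP=> D' /setIdP[D'MEC /forallP agree]; apply: det.
apply/setIdP; split=> //; apply/forallP=> x; apply/forallP=> y.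
have /forallP/(_ y)/implyP agr := agree x; apply/implyP=> xy; apply: agr.
by case/orP: xy => /(subsetP (performed_rcons h v))->; rewrite ?orbT.
Qed.

Lemma known_sound_learn h K v :
  known_sound h K -> known_sound (rcons h v) (learn G D (rcons h v) K).
Proof.
move=> /subsetP sound; apply/subsetP=> e /setUP[/sound|] /setIdP[eG det]; apply/setIdP.
  by split=> //; apply/implyP=> /(implyP det); apply: determined_rcons.
by split=> //; apply/implyP.
Qed.

Let prop_step K K' : digraph {set T} :=
  K :|: [set e in GG | propagates D K' e.1 e.2 || propagates D K' e.2 e.1].

Lemma propagates_mono K K' C1 C2 : K \subset K' -> propagates D K C1 C2 ->
  propagates D K' C1 C2.
Proof.
move=> /subsetP sub /existsP[C0 /and3P[/sub K'C ah inc]].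
by apply/existsP; exists C0; rewrite K'C ah.
Qed.

Lemma prop_step_mono K : {homo prop_step K : A B / A \subset B}.
Proof.
move=> A B AB; apply: setUS; apply/subsetP=> e /setIdP[eG pr]; apply/setIdP; split=> //.
by case/orP: pr => /(propagates_mono AB) ->; rewrite ?orbT.
Qed.

Lemma propagateE K : propagate G D K = prop_step K (propagate G D K).
Proof. by symmetry; apply: fixsetK; apply: prop_step_mono. Qed.

Lemma sub_propagate K : K \subset propagate G D K.
Proof. by rewrite propagateE subsetUl. Qed.

(** Propagation never adds a bidirected edge: the arrowhead it starts from would have to lie on that
    same edge, which is comparable with itself. *)
Lemma known_sound_propagate h K : known_sound h K -> known_sound h (propagate G D K).
Proof.
move=> sound; apply: fixset_min; first exact: prop_step_mono.
have nbid C1 C2 : propagates D [set e in GG | (e \in bid) ==> determined D h e] C1 C2 ->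
    (C1, C2) \notin bid.
  case/existsP=> C0 /and3P[/setIdP[C01 _] ah inc]; apply: contraTN inc => b.
  rewrite (bidirected_unique dagD moralD skelG incG ctG b C01 ah) /incomparable.
  by rewrite setIC subxx.
apply/subUsetP; split; first exact: sound.
apply/subsetP=> [[C1 C2]] /setIdP[eG /orP[]] /nbid nb; apply/setIdP.
  by rewrite (negbTE nb).
by rewrite (bidirected_sym dagD moralD skelG ctG) (negbTE nb).
Qed.

Lemma propagate_next K P C A : (P, C) \in propagate G D K -> (P, C) \in GG ->
  arrowhead D P C -> (C, A) \in GG -> A != P ->
  (C, A) \in propagate G D K /\ (A, C) \in propagate G D K.
Proof.
move=> PCK PC ah CA nAP; have prop : propagates D (propagate G D K) C A.
  by apply/existsP; exists P; rewrite PCK ah incG // eq_sym.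
rewrite propagateE; split; apply/setUP; right; apply/setIdP; rewrite ?prop ?orbT //.
by rewrite GGsymG.
Qed.

Lemma propagate_path K P C s A : (P, C) \in propagate G D K ->
  (C, P) \in propagate G D K -> (P, C) \in GG -> arrowhead D P C ->
  path (arc GG) C s -> uniq (P :: C :: s) -> (last C s, A) \in GG ->
  (last C s, A) \in propagate G D K.
Proof.
elim: s P C => [|B s IHs] P C PCK CPK PC ah.
  move=> _ _ CA; have [->//|nAP] := eqVneq A P.
  by have [] := propagate_next PCK PC ah CA nAP.
move=> /= /andP[CB Bs] /and3P[nP nC unq].
have nBP : B != P by apply: contraNneq nP => <-; rewrite !inE eqxx orbT.
have [CBK BCK] := propagate_next PCK PC ah CB nBP.
apply: (IHs C) => //; last by rewrite /= nC.
exact/points_toW/(arrowhead_next dagD moralD skelG incG ctG PC).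
Qed.

Lemma closest_parentsP C P : P \in closest_parents G D C ->
  (P, C) \in GG /\ points_to D P C.
Proof. by case/setIdP; rewrite inE => /andP[]. Qed.

Lemma points_to_unique P P' C : (P, C) \in GG -> points_to D P C ->
  (P', C) \in GG -> points_to D P' C -> P = P'.
Proof.
move=> PC /points_toW ah P'C /points_toW ah'.
exact: (arrowhead_unique dagD incG ctG PC P'C ah ah').
Qed.

(** A clique has at most one parent, so there is nothing to compare and no edge-intervention in this
    step. *)
Lemma parent_pairs0 C : parent_pairs G D C = set0.
Proof.
apply/setP=> [[P P']]; rewrite in_set0; apply/negP=> /setIP[PP'].
case/setXP=> /closest_parentsP[PC pt] /closest_parentsP[P'C pt'].
by have := tree_neq treeG PP'; rewrite (points_to_unique PC pt P'C pt') eqxx.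
Qed.

Lemma most_upstream_parent C P : (P, C) \in GG -> points_to D P C ->
  most_upstream G D C = [set P].
Proof.
move=> PC pt; have only P' : (P', C) \in GG -> points_to D P' C -> P' = P.
  by move=> P'C pt'; apply: (points_to_unique P'C pt' PC pt).
have Pcl : P \in closest_parents G D C.
  rewrite !inE PC pt; apply/forall_inP=> P'; rewrite !inE => /andP[P'C pt'].
  by rewrite (only P' P'C pt').
apply/setP=> P'; rewrite in_set1; apply/setIdP/eqP => [[/closest_parentsP[P'C pt'] _]|->].
  exact: only.
split=> //; apply/forall_inP=> P0 /closest_parentsP[P0C pt0].
by rewrite (only P0 P0C pt0); apply/implyP=> /(tree_neq treeG); rewrite eqxx.
Qed.

Lemma endpointsP K C : reflect (exists A, ((C, A) \in K) || ((A, C) \in K)) (C \in endpoints K).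
Proof. by rewrite inE; apply: existsP. Qed.

(** An edge of [K] outside [F] would close a cycle in the clique graph, which is a tree. *)
Lemma spanning_tree_eq K F : K \subset GG -> is_tree (endpoints K) F -> F \subset K ->
  F = K.
Proof.
move=> KG treeF FK; apply/eqP; rewrite eqEsubset FK; apply/subsetP=> [[C A]] CA.
have CW : C \in endpoints K by apply/endpointsP; exists A; rewrite CA.
have AW : A \in endpoints K by apply/endpointsP; exists C; rewrite CA orbT.
have CAG := subsetP KG _ CA; have nCA := tree_neq treeG CAG.
have [B CB BA] := tree_first_step treeF CW AW nCA.
suff <- : B = A by [].
have FG : F \subset GG by apply: subset_trans KG.
apply: (tree_branch treeG (subsetP FG _ CB) CAG) (connect0 _ A).
apply: connect_sub BA => u v /and3P[uv nu nv]; apply: connect1.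
by rewrite /avoid /= (subsetP FG _ uv) nu.
Qed.

Lemma branch_out (W : {set {set T}}) F C P : P \notin W :\ C -> branch W F C P = set0.
Proof.
move=> nP; apply/setP=> A; rewrite in_set0; apply/negP=> /setIdP[AW /connectP[[|B p]]].
  by move=> _ /= AP; rewrite -AP AW in nP.
by move=> /= /andP[/setIP[_ /setXP[PW _]]]; rewrite PW in nP.
Qed.

Lemma connect_avoid_branch (W : {set {set T}}) F C A B : is_tree W F ->
  A \in W :\ C -> connect (avoid F C) A B -> B \in branch W F C A.
Proof.
move=> treeF AW AB; apply/setIdP; split.
  case/connectP: AB => p pth ->; elim: p A AW pth => //= B' p IHp A _.
  case/andP=> /and3P[AB' nA nB'] pth; apply: IHp pth.
  by have /andP[_ B'W] := tree_ends treeF AB'; rewrite !inE nB'.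
apply: connect_sub AB => u v /and3P[uv nu nv]; apply: connect1.
have /andP[uW vW] := tree_ends treeF uv.
by apply/setIP; split=> //; apply/setXP; rewrite !inE nu uW nv.
Qed.

(** [K0] is what was known when the round began. Take the path in [F] from [C] to an unknown edge:
    if its first edge has an arrowhead away from [C], propagation reaches the unknown edge;
    otherwise it leads to the unique parent, whose branch is [S]. *)
Lemma downstream_complete K0 K F C S :
  K0 \subset K -> F = GG :\: K0 -> is_tree (endpoints F) F -> C \in endpoints F ->
  unknown_at G C K = set0 ->
  (exists2 P, P \in most_upstream G D C & S = branch (endpoints F) F C P) \/
    most_upstream G D C = set0 ->
  unknown_outside G S (propagate G D K) = set0.
Proof.
move=> K0K defF treeF CW known_at upS; have FG : F \subset GG by rewrite defF subsetDl.
have at_C e : e \in GG -> incident C e -> e \in K.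
  move=> eG inc; apply: contraT => neK; have /setP/(_ e) := known_at.
  by rewrite in_set0; move/negP; case; apply/setIdP; split=> //; apply/setDP.
have K_prop e : e \in K -> e \in propagate G D K by apply/subsetP/sub_propagate.
apply/setP=> [[A B]]; rewrite in_set0; apply/negP=> /setIdP[/setDP[ABG nAB] /= nS].
have ABF : (A, B) \in F.
  by rewrite defF; apply/setDP; split=> //; apply: contra nAB => /(subsetP K0K)/K_prop.
have /andP[AW BW] := tree_ends treeF ABF.
have nAC : A != C.
  by apply: contraNneq nAB => eqC; apply/K_prop/at_C; rewrite // /incident eqC eqxx.
have nBC : B != C.
  by apply: contraNneq nAB => eqC; apply/K_prop/at_C; rewrite // /incident eqC eqxx orbT.
have [[|E s] [pth lst unq]] := tree_path treeF CW AW.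
  by rewrite -lst eqxx in nAC.
have {}lst : last E s = A := lst; have /andP[CEF Es] := pth; have CE := subsetP FG _ CEF.
have EsG : path (arc GG) E s.
  by apply: sub_path Es => u v; apply: (subsetP FG).
have CEK : (C, E) \in propagate G D K by apply/K_prop/at_C; rewrite // /incident eqxx.
have ECK : (E, C) \in propagate G D K.
  by apply/K_prop/at_C; rewrite /incident ?eqxx ?orbT // GGsymG.
have nah : ~~ arrowhead D C E.
  apply: contra nAB => ah; rewrite -lst.
  by apply: (propagate_path CEK ECK) => //; rewrite lst.
have pt : points_to D E C.
  by rewrite /points_to nah (arrowhead_total dagD moralD skelG ctG CE nah).
have EC : (E, C) \in GG by rewrite GGsymG.
have mu := most_upstream_parent EC pt.
case: upS => [[P]|]; rewrite mu; last by move/setP/(_ E); rewrite set11 in_set0.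
move/set1P=> -> defS; case/negP: nS.
have EW : E \in endpoints F :\ C.
  have /andP[_ EW] := tree_ends treeF CEF.
  by rewrite inE EW andbT in_set1 eq_sym (tree_neq treeF CEF).
have EA : connect (avoid F C) E A.
  by rewrite -lst; apply: avoid_path; case/andP: unq.
rewrite defS; apply/andP; split; apply: connect_avoid_branch => //.
apply: connect_trans EA _; apply: connect1.
by rewrite /avoid /= ABF nAC.
Qed.

Lemma undirected_fresh I x y :
  (x, y) \in undirected_part (interventional_essential D I) ->
  [/\ x \notin I, y \notin I & x != y].
Proof.
rewrite inE /= => /and3P[adj nxy nyx].
have fresh : ~~ ((x \in I) || (y \in I)).
  apply/negP=> inI; have com a b : (a, b) \in D -> (a \in I) || (b \in I) ->
      (a, b) \in common_arcs D I.
    move=> ab abI; rewrite inE; apply/forall_inP=> D' /setIdP[_ /forallP agree].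
    by have /forallP/(_ b)/implyP/(_ abI)/eqP-> := agree a.
  case/orP: adj => /com => [/(_ inI)|]; first exact/negP.
  by rewrite orbC => /(_ inI); apply/negP.
move: fresh; rewrite negb_or => /andP[nx ny]; split=> //.
by apply: contraTneq adj => ->; rewrite /adjacent (negbTE (dag_irr _ dagD)).
Qed.

Variable X : {set T}.
Hypothesis hitX : covered_hit D X.

Local Notation m := #|X|.
Local Notation L := (trunc_log 2 #|Q|).
Local Notation res := (residual G D GG).

(** [C] has at least two nodes, one shared with its neighbour [A] and one not, which turns twice the
    half plus one into three times the half. *)
Lemma clique_size C A : (C, A) \in GG -> #|C| <= 3 * m.
Proof.
move=> CA; have /andP[CQ AQ] := tree_ends treeG CA.
have half := clique_half dagD hitX moralD (max_clique_clique skelG CQ).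
have /set0Pn[v /setIP[vC vA]] := clique_graph_meet skelG connG incG ctG CA.
have [w wC nwA] := max_clique_diff CQ AQ (tree_neq treeG CA).
have : 1 < #|C| by apply/card_gt1P; exists v, w; split=> //; apply: contraTneq vA => ->.
by lia.
Qed.

Definition round K F C :=
  [/\ exists2 K0 : digraph {set T}, K0 \subset K & F = GG :\: K0, is_tree (endpoints F) F,
      central (endpoints F) F C & F != set0].

(** In phase 1 the potential is [3 * m] times the logarithm of the number of cliques on unknown
    edges; once the clique-intervention is over, a round is [3 * m] in debt until this number is
    halved. In phase 2 it is twice the number of nodes of [X] in pending residuals. [h1] is the part
    of the history spent on the current clique or residual, and [n] is the number of cliques in the
    tree of the round. *)
Definition run_invariant (s : state T) : Prop :=
  let: State h K pt := s in
  [/\ uniq h, known_sound h K &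
  match pt with
  | FindDCG => size h + 3 * m * trunc_log 2 #|endpoints (GG :\: K)| <= 3 * m * L
  | CliqueIntervention F C => round K F C /\
      exists h0 h1, [/\ h = h0 ++ h1, {subset h1 <= C}
        & size h0 + 3 * m * trunc_log 2 #|endpoints F| <= 3 * m * L]
  | CompareParents F C => [/\ round K F C, unknown_at G C K = set0
        & size h + 3 * m * trunc_log 2 #|endpoints F| <= 3 * m * L + 3 * m]
  | Downstream U => unknown_outside G U (propagate G D K) = set0 /\
      exists n, [/\ 2 * #|U| <= n, 0 < trunc_log 2 n
        & size h + 3 * m * trunc_log 2 n <= 3 * m * L + 3 * m]
  | EdgeIntervention _ _ => False
  | Phase2 F Bs => [/\ F = GG, GG \subset K, Bs \subset comps
        & size h + 2 * (\sum_(B in Bs) #|X :&: res B|) <= 3 * m * L + 2 * m]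
  | ResidualIntervention F Bs R => [/\ F = GG, GG \subset K, Bs \subset comps
      & exists h0 h1, [/\ h = h0 ++ h1, {subset h1 <= R},
          #|R :\: performed h0| <= 2 * #|X :&: R| + 1, size h1 <= 2 * #|X :&: R|
        & size h0 + 2 * (#|X :&: R| + \sum_(B in Bs) #|X :&: res B|) <= 3 * m * L + 2 * m]]
  end].

Lemma round_log K F C : round K F C -> 0 < trunc_log 2 #|endpoints F|.
Proof.
case=> _ treeF _ /set0Pn[[A B] AB]; rewrite trunc_log_gt0 /=.
have /andP[AW BW] := tree_ends treeF AB.
by apply/card_gt1P; exists A, B; split=> //; exact: (tree_neq treeF AB).
Qed.

Lemma round_clique K F C : round K F C -> #|C| <= 3 * m.
Proof.
case=> [[K0 _ defF] _ /andP[CW _] _].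
case/endpointsP: CW => A; rewrite defF; case/orP=> /setDP[CA _]; first exact: clique_size CA.
by apply: (@clique_size C A); rewrite GGsymG.
Qed.

Lemma round_mono K K' F C : K \subset K' -> round K F C -> round K' F C.
Proof.
by move=> KK' [[K0 K0K defF] t c n]; split=> //; exists K0 => //; apply: subset_trans KK'.
Qed.

Lemma learn_sub h K : K \subset learn G D h K.
Proof. exact: subsetUl. Qed.

Lemma uniq_subset_size h (S : {set T}) : uniq h -> {subset h <= S} -> size h <= #|S|.
Proof.
by move=> unq sub; rewrite -(card_uniqP unq); apply/subset_leq_card/subsetP.
Qed.

Lemma cat_uniqr (h0 h1 : seq T) : uniq (h0 ++ h1) -> uniq h1.
Proof. by rewrite cat_uniq => /and3P[]. Qed.

Lemma downstream_start h K F C S : uniq h -> known_sound h K -> round K F C ->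
  unknown_at G C K = set0 ->
  size h + 3 * m * trunc_log 2 #|endpoints F| <= 3 * m * L + 3 * m ->
  (exists2 P, P \in most_upstream G D C & S = branch (endpoints F) F C P) \/
    most_upstream G D C = set0 /\ S = set0 ->
  run_invariant (State h K (Downstream S)).
Proof.
move=> unq sound rnd known_at le_h upS; split=> //; split.
  have [[K0 K0K defF] treeF cen _] := rnd.
  apply: (@downstream_complete K0 K F C) => //; first by case/andP: cen.
  by case: upS => [|[]]; auto.
exists #|endpoints F|; split=> //; last exact: round_log rnd.
case: upS => [[P _ ->]|[_ ->]]; last by rewrite cards0.
have [PW|nPW] := boolP (P \in endpoints F :\ C); last by rewrite branch_out // cards0.
by have [_ _ /andP[_ /forall_inP cen] _] := rnd; apply: cen.
Qed.

Lemma run_step s s' : step G D s s' -> run_invariant s -> run_invariant s'.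
Proof.
case=> {s s'}.
- move=> h K F C neq /andP[/andP[treeF FU] _] cen [unq sound le_h].
  have defF : F = GG :\: K by apply: spanning_tree_eq FU; rewrite ?subsetDl.
  rewrite -defF in treeF neq le_h; split=> //; split; first by split=> //; exists K.
  by exists h, [::]; rewrite cats0.
- move=> h K F C v _ vC [unq sound [rnd [h0 [h1 [defh sub le_h]]]]].
  have {vC} /setDP[vC nv] : v \in C :\: performed h.
    by move: vC; rewrite /clique_choices; case: ifP => // _ /setIdP[].
  rewrite inE in nv; split; first by rewrite rcons_uniq nv.
    exact: known_sound_learn.
  split; first by apply: round_mono rnd; apply: learn_sub.
  exists h0, (rcons h1 v); split=> //; first by rewrite defh rcons_cat.
  by move=> x; rewrite mem_rcons inE => /predU1P[->|/sub].
- move=> h K F C known_at [unq sound [rnd [h0 [h1 [defh sub le_h]]]]].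
  split=> //; split=> //; rewrite defh in unq *; rewrite size_cat.
  have := uniq_subset_size (cat_uniqr unq) sub; have := round_clique rnd; lia.
- by move=> h K e k v _ _ [].
- by move=> h K e k _ [].
- by move=> h K F C e; rewrite parent_pairs0 in_set0.
- move=> h K F C P _ Pup [unq sound [rnd known_at le_h]].
  by apply: downstream_start rnd known_at le_h _ => //; left; exists P.
- move=> h K F C _ mu0 [unq sound [rnd known_at le_h]].
  by apply: downstream_start rnd known_at le_h _ => //; right.
- move=> h K S _ out0 [unq sound [_ le_h]]; split=> //.
    exact: known_sound_propagate.
  split=> //; apply/eqP; rewrite -subset0 -out0; apply/subsetP=> e.
  case/setIdP=> /setDP[eG neK] ne; apply/setIdP; split=> //; apply/setDP; split=> //.
  by apply: contra neK; apply/subsetP/sub_propagate.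
- by move=> h K S e _ eU [_ _ [U0 _]]; move: eU; rewrite U0 in_set0.
- move=> h K S out0 [unq sound [_ [n [leS ltn le_h]]]]; split=> //.
  have sub : endpoints (GG :\: K) \subset S.
    apply/subsetP=> C /endpointsP[A] unk; apply: contraT => nCS.
    suff [e] : exists e, e \in unknown_outside G S K by rewrite out0 in_set0.
    by case/orP: unk => e; [exists (C, A)|exists (A, C)]; apply/setIdP;
      rewrite /= (negbTE nCS) ?andbF.
  (* [S] has at most half of [n] cliques, so the logarithm drops by one, which pays the debt. If
     nothing is unknown, [trunc_log 2 0] is 0 and [ltn] gives the drop. *)
  have : (trunc_log 2 #|endpoints (GG :\: K)|).+1 <= trunc_log 2 n.
    have [->|] := posnP #|endpoints (GG :\: K)|; first by rewrite trunc_log0.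
    move=> pos; rewrite -trunc_log2_double //; apply: leq_trunc_log.
    by apply: leq_trans leS; rewrite -mul2n leq_mul2l subset_leq_card.
  move=> /(leq_mul (leqnn (3 * m))); rewrite mulnS; lia.
- move=> h K F GK ctF _ [unq sound le_h]; split=> //.
  have defF := clique_graph_tree incG ctF.
  split=> //; first by rewrite -defF.
  have := @sum_disjoint_le _ _ X comps res
    (residual_disjoint dagD moralD skelG incG ctG); rewrite -defF; lia.
- move=> h K F Bs B BBs [unq sound [-> GK sub le_h]]; split=> //; split=> //.
    exact: subset_trans (subsetDl _ _) sub.
  exists h, [::]; split=> //; rewrite ?cats0 //; last first.
    by move: le_h; rewrite (big_setD1 B BBs).
  have bound := residual_bound dagD moralD skelG incG ctG hitX (subsetP sub _ BBs).
  apply: bound => C C1 bCC1.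
  apply: (determined_bidirected dagD moralD skelG connG incG ctG bCC1).
  apply: (known_soundP sound _ bCC1); apply: (subsetP GK).
  by case/(bidirectedP dagD moralD skelG ctG): bCC1.
- move=> h K F Bs R v nfull /setDP[vR nv] [unq sound [-> GK sub [h0 [h1 [defh subR leR le1 le0]]]]].
  rewrite inE in nv; have unq' : uniq (rcons h v) by rewrite rcons_uniq nv.
  split=> //; first exact: known_sound_learn.
  split=> //; first by apply: subset_trans GK (learn_sub _ _).
  exists h0, (rcons h1 v); split=> //; first by rewrite defh rcons_cat.
    by move=> x; rewrite mem_rcons inE => /predU1P[->|/subR].
  (* The inequality is strict because an unoriented edge in [R] has two fresh ends, one of which
     remains fresh after [v]. *)
  suff lt : size (rcons h1 v) < #|R :\: performed h0|.
    by have := leq_trans lt leR; rewrite addn1 ltnS.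
  move: nfull; rewrite negb_forall_in => /exists_inP[x xR].
  rewrite negb_forall_in => /exists_inP[y yR]; rewrite negbK.
  case/undirected_fresh; rewrite !inE => nx ny nxy.
  have [w [wR nw nwv]] : exists w, [/\ w \in R, w \notin h & w != v].
    have [xv|nxv] := eqVneq x v; last by exists x.
    by exists y; split=> //; rewrite -xv eq_sym.
  rewrite defh rcons_cat in unq'; have unq1 := cat_uniqr unq'.
  rewrite -(card_uniqP unq1); apply/proper_card/properP; split; last first.
    exists w; first by rewrite !inE wR andbT; apply: contra nw; rewrite defh mem_cat => ->.
    rewrite mem_rcons inE (negbTE nwv) /=; apply: contra nw.
    by rewrite defh mem_cat => ->; rewrite orbT.
  apply/subsetP=> z z1; rewrite !inE; apply/andP; split.
    by move: unq'; rewrite cat_uniq => /and3P[_ /hasPn/(_ z z1)].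
  by move: z1; rewrite mem_rcons inE => /predU1P[->|/subR].
- move=> h K F Bs R _ [unq sound [-> GK sub [h0 [h1 [defh subR leR le1 le0]]]]].
  by split=> //; split=> //; rewrite defh size_cat; lia.
Qed.

(** A run may stop in the middle of a round. The logarithm is then still positive, and its unspent
    term covers the debt. *)
Lemma run_bound s : run_invariant s -> size (history s) <= 3 * m * L + 2 * m.
Proof.
have absorb a b c t l d e : 0 < t -> a + b * t <= b * l -> c <= b -> d <= c ->
    a + d <= b * l + e.
  by move=> /(leq_pmulr b); lia.
have absorb0 a b t l e : 0 < t -> a + b * t <= b * l + b -> a <= b * l + e.
  by move=> /(leq_pmulr b); lia.
case: s => h K pt [unq _]; case: pt => //=.
- by lia.
- move=> F C [rnd [h0 [h1 [defh sub le_h]]]]; rewrite defh in unq *; rewrite size_cat.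
  have := uniq_subset_size (cat_uniqr unq) sub; have := round_clique rnd.
  by move: (round_log rnd) le_h; apply: absorb.
- by move=> F C [/round_log pos _ le_h]; apply: absorb0 le_h.
- by move=> S [_ [n [_ pos le_h]]]; apply: absorb0 le_h.
- by move=> F Bs [_ _ _]; lia.
- by move=> F Bs R [_ _ _ [h0 [h1 [-> _ _ le1 le0]]]]; rewrite size_cat; lia.
Qed.

Lemma run_start : run_invariant (State [::] set0 (FindDCG T)).
Proof.
split=> //; first exact: sub0set.
rewrite add0n leq_mul2l leq_trunc_log ?orbT //; apply/subset_leq_card/subsetP=> C.
by case/endpointsP=> A; rewrite setD0; case/orP=> /(tree_ends treeG)/andP[].
Qed.

End Runs.

(** Rounds are counted by the floor of the logarithm, the final bound by its ceiling. *)
Lemma trunc_log_le_up_log p n : 1 < p -> trunc_log p n <= up_log p n.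
Proof.
move=> p_gt1; have [->|n_gt0] := posnP n; first by rewrite trunc_log0.
rewrite -(leq_exp2l _ _ p_gt1); apply: leq_trans (trunc_logP p_gt1 n_gt0) _.
exact: up_logP.
Qed.

Lemma component_bound (T : finType) (G D : digraph T) (X : {set T}) (h : seq T) :
  is_dag D -> moral D -> (forall x y, ((x, y) \in G) = adjacent D x y) ->
  (forall x y, connect (arc G) x y) -> intersection_incomparable G ->
  covered_hit D X -> component_run G D h ->
  size h <= (3 * up_log 2 #|max_cliques G| + 2) * #|X|.
Proof.
move=> dagD moralD skelG connG incG hitX [K [k run]].
case: (pickP (fun F => is_clique_tree G F)) => [F ctF|no_tree].
  have ctG : is_clique_tree G (clique_graph G) by rewrite (clique_graph_tree incG ctF).
  have inv : run_invariant G D X (State h K k).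
    have := run_start D ctG X; elim: run => // s s' s'' st _ IH.
    by move/(run_step dagD moralD skelG connG incG ctG hitX st).
  have le_h : size h <= _ := run_bound dagD moralD skelG connG incG ctG hitX inv.
  apply: leq_trans le_h _.
  by rewrite mulnDl leq_add2r mulnAC leq_mul2r leq_mul2l trunc_log_le_up_log ?orbT.
(* In the case without clique tree there is no edge to select, and entering phase 2 asks for a
   clique tree: the initial state has no successor. *)
have GG0 : clique_graph G = set0 by rewrite /clique_graph big_pred0.
suff -> : h = [::] by [].
have stuck s s' : step G D s s' -> s = State [::] set0 (FindDCG T) -> False.
  case=> //.
    by move=> h' K' F C ne _ _ [_ E]; move: ne; rewrite GG0 set0D eqxx.
  by move=> h' K' F _; rewrite no_tree.
have stay s s' : clos_refl_trans_1n _ (step G D) s s' ->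
    s = State [::] set0 (FindDCG T) -> s' = s.
  by case=> // t u /stuck st _ /st.
by have [] := stay _ _ run erefl.
Qed.

(* up_log 2 c is the ceiling of the base-2 logarithm of c. *)
Theorem theorem3 (V : finType) (D : {set V * V}) (n : nat) :
  is_dag D ->
  (forall A : {set V}, A \in chain_components D ->
     intersection_incomparable (chain_graph D A)) ->
  dct_policy_uses D n ->
  n <= (3 * up_log 2 (max_clique_count D) + 2) * min_VIS D.
Proof.
move=> dagD inc [h [runs ->]]; rewrite /min_VIS.
case: arg_minnP => [|I visI _]; first exact: is_VIS_setT.
have hitI := VIS_covered_hit dagD visI.
(* The VIS is distributed over the components; its parts [I :&: A] are disjoint, so they add up to
   at most [#|I|]. *)
apply: (@leq_trans (\sum_(A in chain_components D)
    (3 * up_log 2 (max_clique_count D) + 2) * #|I :&: A|)); last first.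
  rewrite -big_distrr leq_mul2l /=; apply/orP; right.
  apply: (@sum_disjoint_le _ _ I (chain_components D) id) => A B x.
  exact: chain_components_disjoint.
apply: leq_sum => A cA; pose X := [set x : {x : V | x \in A} | val x \in I].
have hitX : covered_hit (induced A D) X.
  by move=> u v /(covered_induced dagD cA)/hitI; rewrite !inE.
have := component_bound (induced_dag dagD A) (induced_moral dagD cA)
  (chain_graphE dagD cA) (chain_graph_connected dagD cA) (inc A cA) hitX (runs A cA).
move/leq_trans; apply; apply: leq_mul.
  rewrite leq_add2r leq_mul2l /=; apply: leq_up_log.
  exact: (bigmax_sup A).
rewrite -(card_imset _ val_inj); apply/subset_leq_card/subsetP=> _ /imsetP[x + ->].
by rewrite !inE => ->; rewrite (valP x).
Qed.
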